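(* Let $f:\mathbb R^n\to\mathbb R$ be any measurable almost everywhere finite function such that for every $\varepsilon>0$, $$|\{x\in[-R,R]^n:|f(x)|>\varepsilon\}|=o(R^n)\quad\text{as } R\to\infty .$$ Then for every dyadic lattice $\mathscr D$ in $\mathbb R^n$ and every $\lambda\in(0,2^{-n-2}]$, there exists a regular $6$-Carleson family $\mathcal S\subset\mathscr D$ (depending on $f$) such that $$|f|\le\sum_{Q\in\mathcal S}\omega_\lambda(f;Q)\chi_Q$$ almost everywhere.
   Context: A cube in $\mathbb R^n$ is a half-open cube $[x_1,x_1+\ell)\times\dots\times[x_n,x_n+\ell)$, $\ell>0$. The children of a cube $Q$ are the $2^n$ half-open cubes obtained by halving each edge of $Q$; $\mathcal D(Q)$ denotes the family consisting of $Q$, its children, the children of its children, etc. A dyadic lattice $\mathscr D$ in $\mathbb R^n$ is any collection of cubes such that: (1) if $Q\in\mathscr D$, then each child of $Q$ is in $\mathscr D$; (2) for every $Q',Q''\in\mathscr D$ there exists $Q\in\mathscr D$ with $Q',Q''\in\mathcal D(Q)$; (3) for every compact set $K\subset\mathbb R^n$ there exists a cube $Q\in\mathscr D$ containing $K$. A family $\mathcal S\subset\mathscr D$ is regular if for every compact $K\subset\mathbb R^n$ there exists $Q\in\mathcal S$ containing $K$. For $\Lambda>1$, a family $\mathcal S\subset\mathscr D$ is $\Lambda$-Carleson if $\sum_{P\in\mathcal S,\,P\subset Q}|P|\le\Lambda|Q|$ for every cube $Q\in\mathscr D$. Here $|\cdot|$ is Lebesgue measure and $\chi_Q$ is the characteristic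 function of $Q$. For a non-empty set $E$, $\omega(f;E)=\sup_Ef-\inf_Ef$. For a measurable set $Q$ of finite positive measure and $\lambda\in(0,1)$, the $\lambda$-oscillation of $f$ on $Q$ is $$\omega_\lambda(f;Q)=\inf\{\omega(f;E):E\subset Q\text{ measurable},\ |E|\ge(1-\lambda)|Q|\}.$$ *)

(* Defs.v *)
From HB Require Import structures.
From mathcomp Require Import all_boot all_order all_algebra.
From mathcomp Require Import all_classical all_reals all_analysis.
From mathcomp Require Import measurable_realfun.

Set Implicit Arguments.
Unset Strict Implicit.
Unset Printing Implicit Defensive.
Import Order.TTheory GRing.Theory Num.Theory.
Import numFieldNormedType.Exports.
Local Open Scope classical_set_scope.
Local Open Scope ring_scope.

(** Needed for Landau notations along [+oo]. *)
Canonical pinfty_filter_on (R : realType) :=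
  FilterType (pinfty_nbhs R) _.

Section lebesgue_outer_measure.
Context {R : realType} {n : nat}.
Local Notation Rn := 'rV[R]_n.
Local Open Scope ereal_scope.

Definition box (a b : Rn) : set Rn :=
  [set x | forall i, (a 0%R i <= x 0%R i < b 0%R i)%R].

Definition box_volume (a b : Rn) : R :=
  (\prod_i Num.max 0 (b 0 i - a 0 i))%R.

(** Coverings are by countable, possibly finite or empty, sets of boxes, a box
    being given by its pair of opposite corners. *)
Definition lebesgue_outer (A : set Rn) : \bar R :=
  ereal_inf [set \esum_(ab in C) (box_volume ab.1 ab.2)%:E |
    C in [set C : set (Rn * Rn) |
      countable C /\ A `<=` \bigcup_(ab in C) box ab.1 ab.2]].

Let volume_ge0 (ab : Rn * Rn) : 0 <= (box_volume ab.1 ab.2)%:E.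
Proof.
by rewrite lee_fin; apply: prodr_ge0 => i _; rewrite le_max lexx.
Qed.

Let lebesgue_outer_ge0 A : 0 <= lebesgue_outer A.
Proof. by apply: le_ereal_inf_tmp => _ [C _ <-]; exact: esum_ge0. Qed.

Let lebesgue_outer0 : lebesgue_outer set0 = 0.
Proof.
apply/eqP; rewrite eq_le lebesgue_outer_ge0 andbT.
apply: ereal_inf_lbound; exists set0; last by rewrite esum_set0.
by split; [exact: countable0 | exact: sub0set].
Qed.

Let le_lebesgue_outer : {homo lebesgue_outer : A B / A `<=` B >-> A <= B}.
Proof.
move=> A B AB; apply: ereal_inf_le_tmp => _ [C [cC BC] <-].
by exists C => //; split=> //; exact: subset_trans BC.
Qed.

Let esum_subset (C C' : set (Rn * Rn)) : C `<=` C' ->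
  \esum_(ab in C) (box_volume ab.1 ab.2)%:E <=
  \esum_(ab in C') (box_volume ab.1 ab.2)%:E.
Proof.
move=> CC'; apply: ereal_sup_le => _ [F [finF FC] <-].
by exists F => //; split=> //; exact: subset_trans CC'.
Qed.

Let lebesgue_outer_sigma_subadditive : sigma_subadditive lebesgue_outer.
Proof.
move=> A; have [[i ioo]|] := pselect (exists i, lebesgue_outer (A i) = +oo).
  rewrite (eseries_pinfty _ _ ioo) ?leey// => k _.
  by rewrite -ltNye (lt_le_trans _ (lebesgue_outer_ge0 _)).
rewrite -forallNE => Aoo.
apply/lee_addgt0Pr => _/posnumP[e].
rewrite (le_trans _ (epsilon_trick _ _ _))//.
have [G PG] : {G : (set (Rn * Rn))^nat & forall k,
    (countable (G k) /\ A k `<=` \bigcup_(ab in G k) box ab.1 ab.2) /\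
    \esum_(ab in G k) (box_volume ab.1 ab.2)%:E <=
      lebesgue_outer (A k) + (e%:num / (2 ^ k.+1)%:R)%:E}.
  apply: (@choice _ _ (fun k C =>
    (countable C /\ A k `<=` \bigcup_(ab in C) box ab.1 ab.2) /\
    \esum_(ab in C) (box_volume ab.1 ab.2)%:E <=
      lebesgue_outer (A k) + (e%:num / (2 ^ k.+1)%:R)%:E)) => k.
  have en1 : (0 < e%:num / (2 ^ k.+1)%:R)%R by [].
  have fA : lebesgue_outer (A k) \is a fin_num.
    by rewrite ge0_fin_numE// ltey; exact/eqP/Aoo.
  have [x [C [cC AC] <-] Cx] := lb_ereal_inf_adherent en1 fA.
  by exists C; split=> //; exact/ltW.
apply: (@le_trans _ _ (\esum_(ab in \bigcup_k G k) (box_volume ab.1 ab.2)%:E)).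
  apply: ereal_inf_lbound; exists (\bigcup_k G k) => //; split.
    by apply: bigcup_countable => // k _; exact: (PG k).1.1.
  move=> x [k _ /(PG k).1.2[ab Gab xab]].
  by exists ab => //; exists k.
rewrite seqDU_bigcup_eq (nneseries_sum_bigcup (@trivIset_seqDU _ G))//.
apply: lee_nneseries => k *; last first.
  by apply: le_trans (PG k).2; apply: esum_subset; exact: subset_seqDU.
by exact: esum_ge0.
Qed.

HB.instance Definition _ := isOuterMeasure.Build R Rn lebesgue_outer
  lebesgue_outer0 lebesgue_outer_ge0 le_lebesgue_outer
  lebesgue_outer_sigma_subadditive.

End lebesgue_outer_measure.

(** The points of R^n, with the sigma-algebra of Lebesgue measurable sets. *)
Notation euclid R n := (caratheodory_type (@lebesgue_outer R n)).

Section lebesgue_measure_euclid.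
Context {R : realType} {n : nat}.

Definition lebesgue (A : set (euclid R n)) : \bar R := lebesgue_outer A.

HB.instance Definition _ := isMeasure.Build _ (euclid R n) R lebesgue
  (@caratheodory_measure0 _ _ (@lebesgue_outer R n))
  (@caratheodory_measure_ge0 _ _ (@lebesgue_outer R n))
  (@caratheodory_measure_sigma_additive _ _ (@lebesgue_outer R n)).

End lebesgue_measure_euclid.

Section dyadic_lattices.
Context {R : realType} {n : nat}.
Local Notation Rn := 'rV[R]_n.

Definition cube (x : Rn) (l : R) : set Rn := box x (x + const_mx l).

Definition is_cube (Q : set Rn) : Prop :=
  exists x l, 0 < l /\ Q = cube x l.

(** A child is chosen by the half, lower ([false]) or upper ([true]), that it
    occupies in each coordinate. *)
Definition child (Q P : set Rn) : Prop :=
  exists x l (e : 'I_n -> bool), [/\ 0 < l, Q = cube x l &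
    P = cube (\row_i (x 0 i + (e i)%:R * (l / 2))) (l / 2)].

Inductive descendants (Q : set Rn) : set (set Rn) :=
| descendants_self : descendants Q Q
| descendants_child P P' :
    descendants Q P -> child P P' -> descendants Q P'.

Record dyadic_lattice (D : set (set Rn)) : Prop := {
  dyadic_lattice_cube : forall Q, D Q -> is_cube Q;
  dyadic_lattice_child : forall Q P, D Q -> child Q P -> D P;
  dyadic_lattice_ancestor : forall Q' Q'', D Q' -> D Q'' ->
    exists Q, [/\ D Q, descendants Q Q' & descendants Q Q''];
  dyadic_lattice_compact : forall K, compact K -> exists2 Q, D Q & K `<=` Q
}.

Definition regular_family (S : set (set Rn)) : Prop :=
  forall K : set Rn, compact K -> exists2 Q, S Q & K `<=` Q.

Definition carleson (L : R) (D S : set (set Rn)) : Prop :=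
  forall Q, D Q ->
  (\esum_(P in [set P | S P /\ P `<=` Q]) lebesgue P <= L%:E * lebesgue Q)%E.

End dyadic_lattices.

Section oscillation.
Context {R : realType} {n : nat}.
Local Open Scope ereal_scope.

(** Functions take extended real values, so as to be finite only almost
    everywhere. Where [f] is finite at some point of [E], the difference is
    not of the form [+oo - +oo]. *)
Definition osc (f : euclid R n -> \bar R) (E : set (euclid R n)) : \bar R :=
  ereal_sup (f @` E) - ereal_inf (f @` E).

Definition lambda_osc (lam : R) (f : euclid R n -> \bar R)
    (Q : set (euclid R n)) : \bar R :=
  ereal_inf [set osc f E | E in [set E | [/\ measurable E, E `<=` Q &
    (1 - lam)%:E * lebesgue Q <= lebesgue E]]].

End oscillation.

(* Main.v *)
Require Import Defs.
From HB Require Import structures.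
From mathcomp Require Import all_boot all_order all_algebra.
From mathcomp Require Import all_classical all_reals all_analysis.
From mathcomp Require Import measurable_realfun.
From mathcomp Require Import lra.

Set Implicit Arguments.
Unset Strict Implicit.
Unset Printing Implicit Defensive.
Import Order.TTheory GRing.Theory Num.Theory.
Import numFieldNormedType.Exports.
Local Open Scope classical_set_scope.
Local Open Scope ring_scope.

(** The family is produced by a stopping time that runs through the whole
    lattice at once.

    For each cube [q] of the lattice there is a set [E q], filling [q] up to a
    proportion [lam], on which [f] oscillates by at most its
    [lam]-oscillation: the infimum is attained ([lambda_osc_attained]). Fix a
    cube of the lattice and the chain of its ancestors, which exhausts the
    space. Attach to every cube [q] a cube [stop q] containing it: a cube of the
    chain is attached to itself, and any other cube inherits the attachment [B]
    of its parent, unless [E B] misses more than [2^-(n+1)] of [q], in which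
    case [q] is attached to itself. The family consists of the cubes attached
    to themselves. By construction [E (stop q)] misses at most [2^-(n+1)] of
    [q], for every [q] ([defect_stop]).

    Carleson condition. The cubes of the family strictly below [q] have total
    volume at most [2^(n+2) |q \ E (stop q)|], plus [2 |q|] when [q] is in the
    chain ([below_volume_le]). This bound passes from the children to their
    parent, because [|q \ E B|] is additive over the children of [q], and a new
    stopping cube [c] pays for itself: with [lam <= 2^-(n+2)] it contributes at
    most [|c| + 2^(n+2) |c \ E c| <= 2 |c| < 2^(n+2) |c \ E B|]. So an induction
    on the number of generations suffices, without maximal cubes, and the total
    inside [q], [q] included, is at most [5 |q|].

    Pointwise bound. The points [x] that lie outside [E (stop q)] for all cubes
    [q] around [x] fill at most a quarter of each dyadic cube, hence form a null
    set ([dyadic_density_null], [ae_covered]). For any other [x] take such a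
    [q], let [A 0 = stop q] and [A (i+1) = stop (parent (A i))]. Consecutive
    sets [E (A i)] intersect ([stop_parent_meets]), so on [E (A m)] the function
    [f] differs from [f x] by at most the sum of its [lam]-oscillations on
    [A 0], ..., [A m]. These are distinct cubes of the family around [x], their
    sides at least double at each step, and by the decay hypothesis [|f|] is
    eventually as small as desired somewhere on [E (A m)].

    The measure being given by coverings by boxes, this needs that boxes are
    measurable and that their measure is their volume ([measurable_box],
    [lebesgue_outer_box]). *)

(** * Volume of boxes *)

Section box_measure.
Context {R : realType}.
Local Open Scope ereal_scope.

(** The volume of a box does not exceed that of a countable covering. Instead of
    a compactness argument, integrate the inequality between weighted
    indicators one coordinate at a time, on the line: fixing the first
    coordinate turns its indicators into new weights, which is why weights and
    the constant [c] appear. The coordinates form a list so that induction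
    needs no dependent dimension. *)
Lemma cover_volume_le (I : eqType) (s : seq I) (c : R) (a b : I -> R)
    (w : nat -> R) (A B : nat -> I -> R) :
  uniq s -> (forall j, 0 <= w j)%R ->
  (forall x : I -> R, (forall i, i \in s -> a i <= x i < b i)%R ->
    c%:E <= \sum_(j <oo)
      (w j * \prod_(i <- s) \1_(`[A j i, B j i[%classic) (x i))%:E) ->
  (0 <= c)%R ->
  (c * \prod_(i <- s) Num.max 0 (b i - a i))%:E <=
    \sum_(j <oo) (w j * \prod_(i <- s) Num.max 0 (B j i - A j i))%:E.
Proof.
elim: s c w => [|i s IH] c w /=.
  move=> _ w0 /(_ a) h c0; rewrite big_nil mulr1.
  apply: (le_trans (h _)) => //; apply: lee_nneseries => j _.
    by rewrite lee_fin big_nil mulr1.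
  by rewrite !big_nil.
move=> /andP[is_ us] w0 h c0.
set V := (\prod_(k <- s) Num.max 0 (b k - a k))%R.
pose W j := (\prod_(k <- s) Num.max 0 (B j k - A j k))%R.
have V0 : (0 <= V)%R by apply: prodr_ge0 => k _; rewrite le_max lexx.
have W0 j : (0 <= W j)%R by apply: prodr_ge0 => k _; rewrite le_max lexx.
pose D := `[a i, b i[%classic : set R.
have step t : D t -> (c * V)%:E <=
    \sum_(j <oo) ((w j * W j) * \1_(`[A j i, B j i[%classic) t)%:E.
  rewrite /D/= in_itv/= => tab.
  apply: (le_trans (IH c
    (fun j => w j * \1_(`[A j i, B j i[%classic) t)%R us _ _ c0)).
  - by move=> j; rewrite mulr_ge0.
  - move=> x xs.
    apply: (le_trans (h (fun k => if k == i then t else x k) _)).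
      move=> k; rewrite inE; case: eqP => [->//|_ /=]; exact: xs.
    apply: lee_nneseries => j _.
      by rewrite lee_fin mulr_ge0// prodr_ge0.
    rewrite lee_fin big_cons eqxx mulrA le_eqVlt; apply/orP; left; apply/eqP.
    congr (_ * _)%R; rewrite !big_seq; apply: eq_bigr => k ks.
    by case: eqP => // ki; rewrite -ki ks in is_.
  apply: lee_nneseries => j _; first by rewrite lee_fin -/(W j) !mulr_ge0.
  by rewrite lee_fin -/(W j) mulrAC.
have mD : measurable D by exact: measurable_itv.
have lD (u v : R) :
    (@lebesgue_measure R) `[u, v[%classic = (Num.max 0 (v - u))%:E.
  rewrite lebesgue_measure_itv/= lte_fin; case: ltP => uv.
    by rewrite -EFinB max_r// subr_ge0 ltW.
  by rewrite max_l// subr_le0.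
have -> : (c * \prod_(j <- i :: s) Num.max 0 (b j - a j))%:E =
    \int[@lebesgue_measure R]_(t in D) (cst (c * V)%:E) t.
  rewrite integral_cst// [X in _ = _ * X]lD big_cons -/V -EFinM.
  by rewrite (mulrC (Num.max _ _)) mulrA.
have mI j : measurable_fun D
    (fun t : R => (w j * W j * \1_(`[A j i, B j i[%classic) t)%:E).
  apply/measurable_EFinP; apply: measurable_funM => //.
have I0 j t : 0 <= (w j * W j * \1_(`[A j i, B j i[%classic) t)%:E.
  by rewrite lee_fin !mulr_ge0.
apply: (@le_trans _ _ (\int[@lebesgue_measure R]_(t in D) (\sum_(j <oo)
   ((w j * W j) * \1_(`[A j i, B j i[%classic) t)%:E))).
  apply: ge0_le_integral => //.
  - by move=> t _; rewrite /cst lee_fin mulr_ge0.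
  - by apply: ge0_emeasurable_sum => [k t _ _|k _]; [exact: I0|exact: mI].
rewrite integral_nneseries//.
apply: lee_nneseries => j _.
  by move=> _; apply: integral_ge0 => t _; exact: I0.
under eq_integral do rewrite EFinM.
rewrite ge0_integralZl//; last 2 first.
- exact/measurable_EFinP.
- by rewrite lee_fin mulr_ge0.
rewrite integral_indic// big_cons -/(W j).
rewrite (mulrC (Num.max _ _)) mulrA [in leRHS]EFinM.
apply: lee_wpmul2l; first by rewrite lee_fin mulr_ge0.
rewrite -lD; apply: (@le_measure _ _ _ (@lebesgue_measure R)).
- by rewrite inE; exact: measurableI.
- by rewrite inE.
- exact: subIsetl.
Qed.

End box_measure.

Section outer_box.
Context {R : realType} {n : nat}.
Local Notation Rn := 'rV[R]_n.
Local Open Scope ereal_scope.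

(** Reduces sums over countable sets of boxes to series, for which subadditivity
    and termwise integration are available. *)
Lemma countable_esum_series (T : choiceType) (t0 : T) (C : set T) :
  countable C ->
  exists (P : pred nat) (e : nat -> T), C = [set e k | k in [set k | P k]] /\
    forall a : T -> \bar R, (forall t, 0 <= a t) ->
      \esum_(t in C) a t = \sum_(k <oo | P k) a (e k).
Proof.
move=> /countable_bijP[B]; rewrite card_eq_sym.
pose T' := (HB.pack_for pointedType T (isPointed.Build T t0)).
move=> /(@card_set_bijP _ T' B C)[e bij_e].
exists (fun k => k \in B), e; rewrite set_mem_set; split.
  by case: bij_e => eB _ eC; apply/esym/surj_image_eq => //; exact/image_subP.
move=> a a0; rewrite (reindex_esum B C e)//.
by rewrite nneseries_esum ?set_mem_set.
Qed.

Lemma lebesgue_outer_bigcup_esum (T : choiceType) (t0 : T) (C : set T)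
    (F : T -> set Rn) : countable C ->
  lebesgue_outer (\bigcup_(t in C) F t) <= \esum_(t in C) lebesgue_outer (F t).
Proof.
move=> /(countable_esum_series t0)[P [e [CE ->]]]; last first.
  by move=> t; exact: outer_measure_ge0.
have := outer_measure_sigma_subadditive (@lebesgue_outer R n)
  (fun k => if P k then F (e k) else set0).
move=> /(le_trans _) h; apply: le_trans (h _ _) _.
  apply: le_outer_measure => x [t]; rewrite CE => -[k Pk <-] Fx.
  by exists k => //=; rewrite Pk.
rewrite [leRHS]eseries_mkcond; apply: lee_nneseries => k _.
  by move=> _; exact: outer_measure_ge0.
by case: (P k) => //; rewrite outer_measure0.
Qed.

Lemma lebesgue_outer_box_le (a b : Rn) :
  lebesgue_outer (box a b) <= (box_volume a b)%:E.
Proof.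
apply: ereal_inf_lbound; exists [set (a, b)].
  split; first exact: countable1.
  by move=> x abx; exists (a, b).
rewrite esum_set1// lee_fin; apply: prodr_ge0 => i _.
by rewrite le_max lexx.
Qed.

Lemma lebesgue_outer_box (a b : Rn) :
  lebesgue_outer (box a b) = (box_volume a b)%:E.
Proof.
apply/eqP; rewrite eq_le lebesgue_outer_box_le/=.
apply: le_ereal_inf_tmp => _ [C [cC abC] <-].
have v0 (ab : Rn * Rn) : 0 <= (box_volume ab.1 ab.2)%:E.
  by rewrite lee_fin; apply: prodr_ge0 => i _; rewrite le_max lexx.
have [P [e [CE ->//]]] := countable_esum_series (0, 0)%R cC.
rewrite eseries_mkcond -[box_volume a b]mul1r.
apply: (le_trans (@cover_volume_le R 'I_n (index_enum 'I_n) 1 (a ord0) (b ord0)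
  (fun k => (P k)%:R)%R (fun k => (e k).1 ord0) (fun k => (e k).2 ord0)
  (index_enum_uniq _) _ _ _)) => //.
  move=> x xab.
  have /abC[ab] : box a b (\row_i x i).
    by move=> i; rewrite mxE xab ?mem_index_enum.
  rewrite CE => -[k Pk <-] xk.
  have k0 j : 0 <= ((P j)%:R * \prod_(i < n)
    \1_(`[(e j).1 ord0 i, (e j).2 ord0 i[%classic) (x i))%:E :> \bar R.
    by rewrite lee_fin mulr_ge0// prodr_ge0.
  rewrite (@nneseriesD1 _ _ k xpredT)//.
  rewrite [X in X + _](_ : _ = 1).
    by rewrite leeDl// nneseries_ge0.
  move: Pk => /= ->; rewrite mul1r big1// => i _.
  by rewrite indicE mem_set//= in_itv/=; have := xk i; rewrite mxE.
apply: lee_nneseries => k _.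
  by rewrite lee_fin mulr_ge0//; exact: (v0 (e k)).
by case: (P k); rewrite ?mul1r ?mul0r.
Qed.

Lemma box_halfspaceI (a b : Rn) (i : 'I_n) (c : R) :
  box a b `&` [set x | (x ord0 i < c)%R] =
  box a (\row_j if j == i then Num.min (b ord0 j) c else b ord0 j)%R.
Proof.
apply/seteqP; split=> x.
  move=> [xab /= xc] j; rewrite mxE; have := xab j.
  by case: eqP => // -> /andP[-> ?]; rewrite lt_min xc andbT.
move=> h; split => [j|/=].
  have := h j; rewrite mxE; case: eqP => // _.
  by rewrite lt_min => /and3P[-> -> _].
by have := h i; rewrite mxE eqxx lt_min => /and3P[].
Qed.

Lemma box_halfspaceD (a b : Rn) (i : 'I_n) (c : R) :
  box a b `&` ~` [set x | (x ord0 i < c)%R] =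
  box (\row_j if j == i then Num.max (a ord0 j) c else a ord0 j)%R b.
Proof.
apply/seteqP; split=> x.
  move=> [xab /= /negP]; rewrite -leNgt => xc j; rewrite mxE; have := xab j.
  by case: eqP => // -> /andP[? ->]; rewrite ge_max xc !andbT.
move=> h; split => [j|/=].
  have := h j; rewrite mxE; case: eqP => // _.
  by rewrite ge_max => /andP[/andP[-> _] ->].
apply/negP; rewrite -leNgt.
by have := h i; rewrite mxE eqxx ge_max => /andP[/andP[]].
Qed.

(** A half-space cuts a box into two boxes whose volumes add up, so it splits any
    covering without loss. *)
Lemma measurable_halfspace (i : 'I_n) (c : R) :
  measurable ([set x | ((x : Rn) ord0 i < c)%R] : set (euclid R n)).
Proof.
apply: (@le_caratheodory_measurable R Rn (@lebesgue_outer R n)) => X.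
set H := [set x : Rn | _].
apply: le_ereal_inf_tmp => _ [C [cC XC] <-].
have o0 (A : set Rn) : 0 <= lebesgue_outer A by exact: outer_measure_ge0.
have cut (Y : set Rn) : lebesgue_outer (X `&` Y) <=
    \esum_(ab in C) lebesgue_outer (box ab.1 ab.2 `&` Y).
  apply: le_trans (lebesgue_outer_bigcup_esum (0, 0)%R _ cC).
  by apply: le_outer_measure => x [/XC[ab Cab xab] Yx]; exists ab.
apply: (le_trans (leeD (cut _) (cut _))).
rewrite -esumD//; apply: le_esum => -[a b] _ /=.
rewrite box_halfspaceI box_halfspaceD !lebesgue_outer_box -EFinD lee_fin.
have split_i (u v : Rn) : box_volume u v = (Num.max 0 (v ord0 i - u ord0 i) *
    \prod_(j < n | j != i) Num.max 0 (v ord0 j - u ord0 j))%R.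
  by rewrite /box_volume (bigD1 i).
rewrite !split_i !mxE eqxx.
rewrite (eq_bigr (fun j => Num.max 0 (b ord0 j - a ord0 j))%R); last first.
  by move=> j /negPf ji; rewrite mxE ji.
rewrite [X in (_ + _ * X)%R](eq_bigr
    (fun j => Num.max 0 (b ord0 j - a ord0 j))%R); last first.
  by move=> j /negPf ji; rewrite mxE ji.
rewrite -mulrDl ler_wpM2r//.
  by apply: prodr_ge0 => j _; rewrite le_max lexx.
set u := a _ _; set v := b _ _.
rewrite /Num.max /Num.min.
case: (ltP v c) => vc; case: (ltP u c) => uc; do !case: ltP => ?; lra.
Qed.

Lemma measurable_box (a b : Rn) : measurable (box a b : set (euclid R n)).
Proof.
have -> : box a b = \bigcap_(i in [set: 'I_n])
    ([set x : Rn | (x ord0 i < b ord0 i)%R] `&`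
     ~` [set x : Rn | (x ord0 i < a ord0 i)%R]).
  apply/seteqP; split=> x h.
    move=> i _; have /andP[? ?] := h i; split => //=.
    by apply/negP; rewrite -leNgt.
  by move=> i; have [? /= /negP] := h i I; rewrite -leNgt => -> /=.
apply: (@fin_bigcap_measurable _ (euclid R n)) => // i _.
by apply: measurableI; [|apply: measurableC]; exact: measurable_halfspace.
Qed.

End outer_box.

(** * Dyadic cubes *)

Section dyadic_cubes.
Context {R : realType} {n : nat}.
Local Notation Rn := 'rV[R]_n.
Local Notation cubeT := (Rn * R)%type.
Local Notation corner := {ffun 'I_n -> bool}.

(** Cubes are handled as pairs of a lower corner and a side, so that subdividing
    and comparing sides are computations; [cube_of_inj] says that a cube
    determines its pair. *)
Definition cube_of (q : cubeT) : set Rn := cube q.1 q.2.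

Definition subcube (q : cubeT) (e : corner) : cubeT :=
  (\row_i (q.1 0 i + (e i)%:R * (q.2 / 2)), q.2 / 2).

Definition descend (q : cubeT) (s : seq corner) : cubeT := foldl subcube q s.

Definition volume (q : cubeT) : R := q.2 ^+ n.

Lemma cube_ofP q x : cube_of q x <-> forall i, q.1 0 i <= x 0 i < q.1 0 i + q.2.
Proof. by split => h i; have := h i; rewrite !mxE. Qed.

Lemma cube_of_corner q : 0 < q.2 -> cube_of q q.1.
Proof. by move=> q0; apply/cube_ofP => i; rewrite lexx ltrDl. Qed.

Lemma volume_ge0 q : 0 < q.2 -> 0 <= volume q.
Proof. by move=> q0; rewrite exprn_ge0// ltW. Qed.

Lemma volume_gt0 q : 0 < q.2 -> 0 < volume q.
Proof. by move=> q0; rewrite exprn_gt0. Qed.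

Lemma lebesgue_cube_of q : 0 < q.2 -> lebesgue (cube_of q) = (volume q)%:E.
Proof.
move=> q0; rewrite /lebesgue lebesgue_outer_box; congr _%:E.
rewrite /box_volume (eq_bigr (fun=> q.2)); last first.
  by move=> i _; rewrite !mxE addrAC subrr add0r max_r// ltW.
by rewrite prodr_const card_ord.
Qed.

Lemma measurable_cube_of q : measurable (cube_of q : set (euclid R n)).
Proof. exact: measurable_box. Qed.

Lemma subcube_gt0 q e : 0 < q.2 -> 0 < (subcube q e).2.
Proof. by move=> q0; rewrite divr_gt0. Qed.

Lemma volume_subcube q e : volume (subcube q e) = volume q / 2 ^+ n.
Proof. by rewrite /volume expr_div_n. Qed.

Lemma subcube_sub q e : 0 < q.2 -> cube_of (subcube q e) `<=` cube_of q.
Proof.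
move=> q0 x /cube_ofP xe; apply/cube_ofP => i; have := xe i; rewrite !mxE/=.
by case: (e i); rewrite ?mul1r ?mul0r; lra.
Qed.

Lemma subcube_cover q x : cube_of q x -> exists e, cube_of (subcube q e) x.
Proof.
move=> /cube_ofP xq; exists [ffun i => q.1 0 i + q.2 / 2 <= x 0 i].
apply/cube_ofP => i; have := xq i; rewrite !mxE/= ffunE.
by case: (leP (q.1 0 i + q.2 / 2)) => h; rewrite ?mul1r ?mul0r; lra.
Qed.

Lemma subcube_disjoint q e e' x :
  cube_of (subcube q e) x -> cube_of (subcube q e') x -> e = e'.
Proof.
move=> /cube_ofP xe /cube_ofP xe'; apply/ffunP => i; have := xe i; have := xe' i.
by rewrite !mxE/=; case: (e i); case: (e' i) => //; rewrite ?mul1r ?mul0r; lra.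
Qed.

Lemma side_descend q s : (descend q s).2 = q.2 / 2 ^+ size s.
Proof.
elim: s q => [|e s IH] q /=; first by rewrite expr0 divr1.
by rewrite IH/= exprS invfM mulrA.
Qed.

Lemma descend_gt0 q s : 0 < q.2 -> 0 < (descend q s).2.
Proof. by move=> q0; rewrite side_descend divr_gt0// exprn_gt0. Qed.

Lemma descend_cat q s t : descend q (s ++ t) = descend (descend q s) t.
Proof. exact: foldl_cat. Qed.

Lemma descend_rcons q s e : descend q (rcons s e) = subcube (descend q s) e.
Proof. by rewrite -cats1 descend_cat. Qed.

Lemma descend_sub q s : 0 < q.2 -> cube_of (descend q s) `<=` cube_of q.
Proof.
elim: s q => [|e s IH] q q0 //=.
by apply: subset_trans (subcube_sub q0); apply: IH; exact: subcube_gt0.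
Qed.

Lemma descend_disjoint q s t x : 0 < q.2 -> size s = size t ->
  cube_of (descend q s) x -> cube_of (descend q t) x -> s = t.
Proof.
elim: s t q => [|e s IH] [|e' t] q//= q0 [st] xs xt.
have ee' : e = e'.
  apply: (@subcube_disjoint q _ _ x).
    by apply: (@descend_sub (subcube q e) s) xs; exact: subcube_gt0.
  by apply: (@descend_sub (subcube q e') t) xt; exact: subcube_gt0.
by subst e'; congr cons; apply: IH xs xt => //; exact: subcube_gt0.
Qed.

Lemma descend_cover q x d : cube_of q x ->
  exists2 s, size s = d & cube_of (descend q s) x.
Proof.
elim: d q => [|d IH] q xq; first by exists [::].
have [e /IH[s sd xs]] := subcube_cover xq.
by exists (e :: s) => //=; rewrite sd.
Qed.

(** Fails in dimension [0], where all cubes coincide. *)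
Lemma cube_of_inj q q' : (0 < n)%N -> 0 < q.2 -> 0 < q'.2 ->
  cube_of q = cube_of q' -> q = q'.
Proof.
move=> n0 q0 q'0 qq'.
have /cube_ofP c1 : cube_of q' q.1 by rewrite -qq'; exact: cube_of_corner.
have /cube_ofP c2 : cube_of q q'.1 by rewrite qq'; exact: cube_of_corner.
have e1 : q.1 = q'.1.
  apply/rowP => i; apply/eqP; rewrite eq_le.
  by have /andP[-> _] := c1 i; have /andP[-> _] := c2 i.
have side (p p' : cubeT) : p.1 = p'.1 -> 0 < p.2 -> cube_of p' `<=` cube_of p ->
    p'.2 <= p.2.
  move=> pp' p0 h; rewrite leNgt; apply/negP => pp.
  have /h/cube_ofP/(_ (Ordinal n0)) : cube_of p' (p.1 + const_mx p.2).
    by apply/cube_ofP => i; rewrite pp' !mxE; lra.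
  by rewrite !mxE ltxx andbF.
case: q q' q0 q'0 qq' {c1 c2} e1 => [x l] [y m] /= l0 m0 xy xE.
congr pair => //; apply/eqP; rewrite eq_le.
apply/andP; split.
  by apply: (side (y, m) (x, l)); rewrite //= xy.
by apply: (side (x, l) (y, m)); rewrite //= xy.
Qed.

Lemma le_lebesgue (A B : set (euclid R n)) :
  A `<=` B -> (lebesgue A <= lebesgue B)%E.
Proof. exact: (le_outer_measure (@lebesgue_outer R n)). Qed.

Lemma sum_measure_disjoint_le (I : finType) (F : I -> set (euclid R n))
    (G : set (euclid R n)) :
  (forall i, measurable (F i)) -> measurable G -> (forall i, F i `<=` G) ->
  (forall i j x, F i x -> F j x -> i = j) ->
  (\sum_i lebesgue (F i) <= lebesgue G)%E.
Proof.
move=> mF mG FG dF.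
have mU : measurable (\bigcup_(i in [set: I]) F i).
  exact: fin_bigcup_measurable.
apply: (@le_trans _ _ (lebesgue (\bigcup_(i in [set: I]) F i))).
  have tF : trivIset [set: I] F.
    by move=> i j _ _ [x [xi xj]]; exact: dF xi xj.
  have fI : finite_set [set: I] by exact: finite_finset.
  rewrite (measure_fin_bigcup lebesgue fI tF)//.
  rewrite (_ : [set: I] = [set` enum I]); last first.
    by apply/seteqP; split=> i //=; rewrite mem_enum.
  by rewrite -fsbig_seq ?enum_uniq// big_enum.
by apply: le_lebesgue => x [i _]; exact: FG.
Qed.

End dyadic_cubes.

(** * Dyadic density *)

Section null_sets.
Context {R : realType} {n : nat}.
Local Notation Rn := 'rV[R]_n.
Local Notation cubeT := (Rn * R)%type.
Local Notation corner := {ffun 'I_n -> bool}.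

Lemma pow2_small (l e : R) : 0 < l -> 0 < e -> exists d, l / 2 ^+ d < e.
Proof.
move=> l0 e0; exists (Num.truncn (l / e)).+1.
rewrite ltr_pdivrMr ?exprn_gt0// mulrC -ltr_pdivrMr//.
apply: (lt_le_trans (truncnS_gt _)).
by rewrite -natrX ler_nat ltnW// ltn_expl.
Qed.

Lemma enlarged_volume_le (s : 'I_n -> R) : (forall i, 0 < s i) ->
  exists2 e, 0 < e &
    forall t, 0 < t < e -> \prod_i (s i + 2 * t) <= 2 * \prod_i s i.
Proof.
move=> s0; pose p : {poly R} := \prod_i ((s i)%:P + 2%:P * 'X).
have pE t : p.[t] = \prod_i (s i + 2 * t).
  by rewrite /p horner_prod; apply: eq_bigr => i _; rewrite !hornerE.
have S0 : 0 < \prod_i s i by apply: prodr_gt0.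
have p0 : p.[0] < 2 * \prod_i s i.
  rewrite pE (eq_bigr s); last by move=> i _; rewrite mulr0 addr0.
  by rewrite ltr_pMl// ltr1n.
have /nbhs_ballP[e /= e0 h] : nbhs (0 : R) [set t | p.[t] < 2 * \prod_i s i].
  have hp : horner p x @[x --> (0:R)] --> p.[0] by exact: continuous_horner.
  exact: (cvgr_lt _ hp _ p0).
exists e => // t /andP[t0 te].
rewrite -pE; apply/ltW/h.
by rewrite /ball/= sub0r normrN gtr0_norm.
Qed.

Lemma lebesgue_outer_finU (I : finType) (F : I -> set Rn) :
  (lebesgue_outer (\bigcup_i F i) <= \sum_i lebesgue_outer (F i))%E.
Proof.
have [i0|I0] := pickP (fun _ : I => true); last first.
  rewrite (_ : \bigcup_i F i = set0); last first.
    by apply/seteqP; split => // x [i]; have := I0 i.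
  rewrite outer_measure0 sume_ge0// => i _; exact: outer_measure_ge0.
move=> _; have fI : finite_set [set: I] by exact: finite_finset.
apply: (le_trans (lebesgue_outer_bigcup_esum i0 _ (finite_set_countable fI))).
rewrite esum_fset//; last by move=> i _; exact: outer_measure_ge0.
rewrite (_ : [set: I] = [set` enum I]); last first.
  by apply/seteqP; split=> i //=; rewrite mem_enum.
by rewrite -fsbig_seq ?enum_uniq// big_enum.
Qed.

(** A box is covered by the descendants of [q] of a small side [t] that meet it.
    They are disjoint and lie in the box enlarged by [t] on all sides, whose
    volume is at most twice that of the box; the factor [2] is affordable
    because the density of [B] in cubes is a quarter. *)
Lemma dyadic_density_box (q : cubeT) (B : set Rn) (a b : Rn) : 0 < q.2 ->
  B `<=` cube_of q ->
  (forall s, lebesgue_outer (B `&` cube_of (descend q s)) <=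
    (volume (descend q s) / 4)%:E)%E ->
  (lebesgue_outer (B `&` box a b) <= (box_volume a b / 2)%:E)%E.
Proof.
move=> q0 Bq Bs.
have v0 : 0 <= box_volume a b.
  by apply: prodr_ge0 => i _; rewrite le_max lexx.
have [|ab] := pselect (exists i, b 0 i <= a 0 i).
  move=> [i bai]; rewrite (_ : B `&` _ = set0).
    by rewrite outer_measure0 lee_fin divr_ge0.
  by apply/seteqP; split => // x [_ /(_ i)]/andP[ax xb]; lra.
have {}ab i : 0 < b 0 i - a 0 i.
  by rewrite subr_gt0 ltNge; apply/negP => bai; apply: ab; exists i.
have [e e0 he] := enlarged_volume_le ab.
have [d dE] := pow2_small q0 e0.
set t := q.2 / 2 ^+ d in dE.
have t0 : 0 < t by rewrite divr_gt0// exprn_gt0.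
pose meets (s : d.-tuple corner) :=
  `[< cube_of (descend q s) `&` box a b !=set0 >].
pose F (s : d.-tuple corner) := if meets s then cube_of (descend q s) else set0.
have side (s : d.-tuple corner) : (descend q s).2 = t.
  by rewrite side_descend size_tuple.
apply: (@le_trans _ _ (\sum_s lebesgue_outer (B `&` F s))%E).
  apply: le_trans (lebesgue_outer_finU _); apply: le_outer_measure => x [Bx xab].
  have [s sd xs] := descend_cover d (Bq _ Bx).
  exists (tcast sd (in_tuple s)) => //; split => //.
  rewrite /F /meets val_tcast/= asboolT//.
  by exists x.
apply: (@le_trans _ _ (\sum_s (fine (lebesgue (F s)) / 4)%:E)%E).
  apply: lee_sum => s _; rewrite /F; case: ifP => _.
    by rewrite lebesgue_cube_of ?descend_gt0//= Bs.
  by rewrite setI0 /lebesgue !outer_measure0 mul0r.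
have FE s : lebesgue (F s) = (fine (lebesgue (F s)))%:E.
  rewrite /F; case: ifP => _; first by rewrite lebesgue_cube_of ?descend_gt0.
  by rewrite /lebesgue !outer_measure0.
pose a' : Rn := \row_i (a 0 i - t); pose b' : Rn := \row_i (b 0 i + t).
have := @sum_measure_disjoint_le R n _ F (box a' b').
rewrite (eq_bigr _ (fun s _ => FE s)) sumEFin => sumF.
rewrite sumEFin lee_fin -mulr_suml.
suff : \sum_s fine (lebesgue (F s)) <= 2 * box_volume a b by lra.
rewrite -lee_fin; apply: le_trans (sumF _ _ _ _) _.
- move=> s; rewrite /F; case: ifP => _; last exact: measurable0.
  exact: measurable_cube_of.
- exact: measurable_box.
- move=> s x; rewrite /F /meets; case: asboolP => //.
  move=> [y [/cube_ofP ys yab]] /cube_ofP xs i; rewrite !mxE.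
  by have := ys i; have := yab i; have := xs i; rewrite side; lra.
- move=> s s' x; rewrite /F; case: ifP => // _; case: ifP => // _ xs xs'.
  by apply: val_inj; apply: descend_disjoint xs xs' => //; rewrite !size_tuple.
rewrite /lebesgue lebesgue_outer_box lee_fin /box_volume.
rewrite (eq_bigr (fun i => b 0 i - a 0 i + 2 * t)); last first.
  by move=> i _; rewrite !mxE max_r; have := ab i; lra.
rewrite [in leRHS](eq_bigr (fun i => b 0 i - a 0 i)); last first.
  by move=> i _; rewrite max_r// ltW.
by apply: he; rewrite t0.
Qed.

(** A set of positive outer measure has a covering by boxes of total volume less
    than twice its measure; the density bound of [dyadic_density_box] in each
    of these boxes contradicts this. *)
Lemma dyadic_density_null (q : cubeT) (B : set Rn) : 0 < q.2 ->
  B `<=` cube_of q ->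
  (forall s, lebesgue_outer (B `&` cube_of (descend q s)) <=
    (volume (descend q s) / 4)%:E)%E ->
  lebesgue_outer B = 0%E.
Proof.
move=> q0 Bq Bs; apply/eqP; apply/negPn/negP => B0.
have fB : lebesgue_outer B \is a fin_num.
  rewrite ge0_fin_numE ?outer_measure_ge0//.
  apply: (@le_lt_trans _ _ (lebesgue_outer (cube_of q))).
    exact: le_outer_measure.
  by have := lebesgue_cube_of q0; rewrite /lebesgue => ->; exact: ltry.
have Bpos : 0 < fine (lebesgue_outer B).
  rewrite fine_gt0// lt0e B0 outer_measure_ge0 -ge0_fin_numE//.
  exact: outer_measure_ge0.
have [_ [C [cC BC] <-]] := lb_ereal_inf_adherent Bpos fB.
rewrite -/(lebesgue_outer B) fineK//; apply/negP; rewrite -leNgt.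
pose h (ab : Rn * Rn) := (box_volume ab.1 ab.2 / 2)%:E.
have h0 ab : (0 <= h ab)%E.
  by rewrite lee_fin divr_ge0// prodr_ge0// => i _; rewrite le_max lexx.
rewrite (eq_esum (b := fun ab => (h ab + h ab)%E)); last first.
  by move=> ab _; rewrite -EFinD -splitr.
rewrite esumD//.
suff Bh : (lebesgue_outer B <= \esum_(ab in C) h ab)%E by exact: leeD.
apply: (@le_trans _ _ (\esum_(ab in C) lebesgue_outer (B `&` box ab.1 ab.2))%E).
  apply: le_trans (lebesgue_outer_bigcup_esum (0, 0) _ cC).
  by apply: le_outer_measure => x Bx; have [ab Cab xab] := BC _ Bx; exists ab.
by apply: le_esum => ab _; exact: dyadic_density_box q0 Bq Bs.
Qed.

End null_sets.

(** * Sets on which the oscillation is attained *)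

Section optimal_sets.
Context {R : realType} {n : nat}.
Implicit Types (Q E : set (euclid R n)).
Local Open Scope ereal_scope.

Lemma subset_overlap Q (E1 E2 : set (euclid R n)) :
  lebesgue (Q `\` E1) + lebesgue (Q `\` E2) < lebesgue Q ->
  exists x, [/\ Q x, E1 x & E2 x].
Proof.
apply: contraPP => /forallNP h; apply/negP; rewrite -leNgt.
apply: le_trans (outer_measureU2 (@lebesgue_outer R n) _ _).
apply: le_lebesgue => x Qx.
have [E1x|E1x] := pselect (E1 x); [right|left] => //.
by split=> // E2x; apply: (h x).
Qed.

Variables (f : euclid R n -> \bar R) (lam : R) (Q : set (euclid R n)) (v : R).
Hypotheses (mf : measurable_fun [set: euclid R n] f)
  (ae_fin : {ae lebesgue, forall x, f x \is a fin_num})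
  (mQ : measurable Q) (v0 : (0 < v)%R) (Qv : lebesgue Q = v%:E)
  (lam0 : (0 < lam)%R) (lam2 : (lam < 2^-1)%R).

Let admissible E := [/\ measurable E, E `<=` Q &
  (1 - lam)%:E * lebesgue Q <= lebesgue E].

Let admissible_gt0 E : admissible E -> 0 < lebesgue E.
Proof.
move=> [_ _ lE]; apply: lt_le_trans lE; rewrite Qv -EFinM lte_fin mulr_gt0//.
by move: lam2; lra.
Qed.

Let finite_point E : 0 < lebesgue E -> exists2 x, E x & f x \is a fin_num.
Proof.
move=> E0; have [N [mN N0 fN]] := ae_fin.
apply: contrapT => h; move: E0; apply/negP; rewrite -leNgt -N0.
apply: le_lebesgue => x Ex; apply: fN => /= fx; apply: h.
by exists x.
Qed.

Let admissible_compl E : admissible E -> lebesgue (Q `\` E) <= (lam * v)%:E.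
Proof.
move=> [mE EQ lE].
have fE : lebesgue E \is a fin_num.
  rewrite ge0_fin_numE; last exact: outer_measure_ge0.
  by rewrite (le_lt_trans (le_lebesgue EQ))// Qv ltry.
have QE : lebesgue (Q `\` E) = lebesgue Q - lebesgue E.
  by rewrite [LHS](measureD mQ mE)/= ?(setIidr EQ)// Qv ltry.
move: lE; rewrite QE Qv -(fineK fE) -EFinM -EFinB !lee_fin; lra.
Qed.

Let slab (c d : R) := Q `&` f @^-1` `[c%:E, d%:E]%classic.

Let measurable_slab c d : measurable (slab c d).
Proof.
apply: measurableI => //; rewrite -[X in measurable X]setTI; apply: mf => //.
exact: emeasurable_itv.
Qed.

Let slab_fin c d x : slab c d x -> f x \is a fin_num.
Proof.
move=> [_]; rewrite /= in_itv/=; case: (f x) => [//||] /andP[].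
  by move=> _; rewrite leye_eq.
by rewrite leeNy_eq.
Qed.

Let slab_osc c d x y : slab c d x -> slab c d y ->
  `|f x - f y| <= (d - c)%:E.
Proof.
move=> /[dup] /slab_fin + [_ /=]; rewrite in_itv/=; case: (f x) => // a _ ha.
move=> /[dup] /slab_fin + [_ /=]; rewrite in_itv/=; case: (f y) => // b _ hb.
move: ha hb; rewrite !lee_fin ler_norml; lra.
Qed.

(** A set competing for the infimum may be enlarged to the part of [Q] where [f]
    takes its values in a given interval. Its positive measure provides a point
    where [f] is finite, which excludes infinite bounds. *)
Let admissible_slab E w : admissible E -> osc f E < w%:E ->
  exists c, admissible (slab c (c + w)).
Proof.
move=> aE; have [x Ex fx] := finite_point (admissible_gt0 aE).
have fxs : f x <= ereal_sup (f @` E) by apply: ereal_sup_ubound; exists x.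
have fxi : ereal_inf (f @` E) <= f x by apply: ereal_inf_lbound; exists x.
rewrite /osc; case si : (ereal_inf _) fxi => [i||] fxi; last 2 first.
- by move: fx fxi; case: (f x).
- by move: fx fxs; case: (f x) => // r _; case: (ereal_sup _).
case ss : (ereal_sup _) fxs => [s||] fxs; last 2 first.
- by [].
- by move: fx fxs; case: (f x).
rewrite -EFinB lte_fin => sw; exists i; split => //.
  exact: subIsetl.
case: aE => [mE EQ]; move=> /le_trans; apply; apply: le_lebesgue => y Ey.
split; first exact: EQ.
rewrite /= in_itv/= -si ereal_inf_lbound//=; last by exists y.
apply: (@le_trans _ _ (ereal_sup (f @` E))).
  by apply: ereal_sup_ubound; exists y.
by rewrite ss lee_fin; lra.
Qed.

Let admissible_overlap E1 E2 : admissible E1 -> admissible E2 ->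
  exists x, E1 x /\ E2 x.
Proof.
move=> /admissible_compl h1 /admissible_compl h2.
have [|x []] := @subset_overlap Q E1 E2; last by exists x.
apply: le_lt_trans (leeD h1 h2) _; rewrite Qv -EFinD lte_fin.
have : (lam * v < 2^-1 * v)%R by rewrite ltr_pM2r.
lra.
Qed.

Let lambda_osc_adherent w e : lambda_osc lam f Q = w%:E -> (0 < e)%R ->
  exists c, admissible (slab c (c + (w + e))).
Proof.
move=> wE e0.
have [] := lb_ereal_inf_adherent
  (S := [set osc f E | E in [set E | admissible E]]) e0.
  by rewrite [X in X \is a _]wE.
move=> _ [E aE <-]; rewrite [ereal_inf _]wE -EFinD; exact: admissible_slab.
Qed.

(** The intervals of near-optimal slabs pairwise intersect, as each slab fills
    more than half of [Q]. Hence their left ends are bounded, and have a cluster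
    point [p]. *)
Let limit_slab w : lambda_osc lam f Q = w%:E ->
  exists p : R, forall e, (0 < e)%R -> admissible (slab (p - e) (p + w + e)).
Proof.
move=> wE.
pose e_ (k : nat) : R := (k.+1%:R^-1)%R.
have e_0 k : (0 < e_ k)%R by rewrite invr_gt0.
have e_1 k : (e_ k <= 1)%R by rewrite invf_le1// ler1n.
have [c hc] := choice (fun k => lambda_osc_adherent wE (e_0 k)).
pose lo : R := (c 0%N - (w + 1))%R; pose hi : R := (c 0%N + (w + 1))%R.
have c_bound k : (`[lo, hi]%classic : set R) (c k).
  have [x [xk x0]] := admissible_overlap (hc k) (hc 0%N).
  have := slab_fin xk; case: xk => _; case: x0 => _; rewrite /= !in_itv/=.
  rewrite /lo /hi; case: (f x) => // r; rewrite !lee_fin.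
  by have := e_1 k; have := e_1 0%N; lra.
have [p [_ cp]] := @segment_compact R lo hi (c @ \oo) _ (filterE _ c_bound).
exists p => e e0.
have e20 : (0 < e / 2)%R by rewrite divr_gt0.
have near_e : (c @ \oo) [set c k | k in [set k | e_ k < e / 2]%R].
  have := @near_infty_natSinv_lt R (PosNum e20).
  by apply: filterS => k /= ke; exists k.
have [_ [[k /= ke <-]]] := cp _ _ near_e (nbhsx_ballx p _ e20).
rewrite /ball/= => pc; have [mk _ lk] := hc k.
split => //; first exact: subIsetl.
apply: (le_trans lk); apply: le_lebesgue => x xk.
have := slab_fin xk; case: xk => Qx; rewrite /= !in_itv/= => fx ffx.
split=> //=.
rewrite in_itv/=.
move: fx ffx; case: (f x) => // r; rewrite !lee_fin => + _.
by move: pc; rewrite ltr_norml; lra.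
Qed.

Lemma lambda_osc_ge0 : 0 <= lambda_osc lam f Q.
Proof.
apply: le_ereal_inf_tmp => _ [E aE <-].
have [x Ex fx] := finite_point (admissible_gt0 aE).
have fxs : f x <= ereal_sup (f @` E) by apply: ereal_sup_ubound; exists x.
have fxi : ereal_inf (f @` E) <= f x by apply: ereal_inf_lbound; exists x.
move: fxs fxi fx; rewrite /osc; case: (f x) => // r.
case: (ereal_sup _) => [s||]//; case: (ereal_inf _) => [i||]// + + _.
  by rewrite -EFinB !lee_fin; lra.
all: by move=> *; exact: leey.
Qed.

(** When the infimum [w] is finite, the slab over [[p, p + w]] is the intersection
    of the decreasing sequence of slabs over [[p - e, p + w + e]], and continuity
    from above shows that it is large enough. When it is infinite, the points
    of [Q] where [f] is finite do. *)
Lemma lambda_osc_attained : exists E, [/\ measurable E,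
  lebesgue (Q `\` E) <= (lam * v)%:E,
  (forall x, E x -> Q x /\ f x \is a fin_num) &
  forall x y, E x -> E y -> `|f x - f y| <= lambda_osc lam f Q].
Proof.
case wE : (lambda_osc lam f Q) => [w| |].
- have [p hp] := limit_slab wE.
  pose e_ (k : nat) : R := (k.+1%:R^-1)%R.
  have e_0 k : (0 < e_ k)%R by rewrite invr_gt0.
  have aE : admissible (slab p (p + w)).
    split => //; first exact: subIsetl.
    pose F k := slab (p - e_ k) (p + w + e_ k).
    have FE : \bigcap_k F k = slab p (p + w).
      apply/seteqP; split=> x.
        move=> h; have [Qx _] := h 0%N I; have fx := slab_fin (h 0%N I).
        split=> //=; rewrite in_itv/=.
        have {}h k : (p - e_ k <= fine (f x) <= p + w + e_ k)%R.
          have [_] := h k I; rewrite /= in_itv/=.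
          by move: fx; case: (f x) => // r _; rewrite !lee_fin.
        move: fx h; case: (f x) => // r _ /= h; rewrite !lee_fin.
        apply/andP; split; apply/ler_addgt0Pr => e e0;
          have [k _ /(_ k (leqnn k)) /= ke] :=
            @near_infty_natSinv_lt R (PosNum e0);
          by have := h k; move: ke; rewrite -/(e_ k); lra.
      move=> xs k _; have fx := slab_fin xs; have [Qx fs] := xs; split=> //.
      move: fs; rewrite /= !in_itv/=; move: fx; case: (f x) => // r _.
      by rewrite !lee_fin; have := e_0 k; lra.
    rewrite -FE.
    have cF : lebesgue \o F @ \oo --> lebesgue (\bigcap_k F k).
      apply: nonincreasing_cvg_mu => //=.
      - by rewrite (le_lt_trans (le_lebesgue (@subIsetl _ _ _)))// Qv ltry.
      - by move=> k; exact: measurable_slab.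
      - by apply: bigcapT_measurable => k; exact: measurable_slab.
      - apply/nonincreasing_seqP => k; apply/subsetPset => x xs.
        have fx := slab_fin xs; have [Qx fs] := xs; split=> //.
        move: fs; rewrite /= !in_itv/=; move: fx; case: (f x) => // r _.
        rewrite !lee_fin.
        have : (e_ k.+1 <= e_ k)%R by rewrite lef_pV2 ?posrE// ler_nat.
        by lra.
    rewrite -(cvg_lim _ cF)//; apply: lime_ge; first exact: cvgP cF.
    by apply: nearW => k; have [] := hp _ (e_0 k).
  exists (slab p (p + w)); split.
  + exact: measurable_slab.
  + exact: admissible_compl.
  + by move=> x xs; split; [case: xs|exact: slab_fin xs].
  + move=> x y xs ys; apply: le_trans (slab_osc xs ys) _.
    by rewrite lee_fin; lra.
- exists (Q `&` [set x | f x \is a fin_num]); split.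
  + apply: emeasurable_fin_num => //; exact: measurable_funS mf.
  + have [N [mN N0 fN]] := ae_fin.
    apply: (@le_trans _ _ (lebesgue N)).
      by apply: le_lebesgue => x [Qx nfx]; apply: fN => fx; apply: nfx.
    by rewrite N0 lee_fin mulr_ge0// ltW.
  + by [].
  + by move=> *; rewrite leey.
- by have := lambda_osc_ge0; rewrite wE.
Qed.

End optimal_sets.

(** * Parents in a dyadic lattice *)

Section lattice.
Context {R : realType} {n : nat}.
Local Notation Rn := 'rV[R]_n.
Local Notation cubeT := (Rn * R)%type.
Local Notation corner := {ffun 'I_n -> bool}.
Implicit Types (p q t : cubeT) (s : seq corner) (e : corner) (P Q : set Rn).
Variable D : set (set Rn).
Hypotheses (n_gt0 : (0 < n)%N) (latD : dyadic_lattice D).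

Definition in_lattice (q : cubeT) := 0 < q.2 /\ D (cube_of q).

Lemma side_le_sub (p q : cubeT) : 0 < p.2 -> 0 < q.2 ->
  cube_of p `<=` cube_of q -> p.2 <= q.2.
Proof.
move=> p0 q0 pq; rewrite leNgt; apply/negP => qp.
have /pq/cube_ofP/(_ (Ordinal n_gt0)) : cube_of p (p.1 + const_mx q.2).
  by apply/cube_ofP => i; rewrite !mxE; lra.
have /pq/cube_ofP/(_ (Ordinal n_gt0)) := cube_of_corner p0.
by rewrite !mxE; lra.
Qed.

Lemma lattice_cube_of Q : D Q -> exists2 q, in_lattice q & Q = cube_of q.
Proof.
move=> DQ; have [x [l [l0 QE]]] := dyadic_lattice_cube latD DQ.
by exists (x, l) => //; split => //; rewrite /cube_of/= -QE.
Qed.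

Lemma child_subcube q P : 0 < q.2 -> child (cube_of q) P ->
  exists e, P = cube_of (subcube q e).
Proof.
move=> q0 [x [l [e [l0 qE ->]]]].
have -> : q = (x, l) by exact: cube_of_inj.
exists [ffun i => e i]; congr cube.
by apply/rowP => i; rewrite !mxE ffunE.
Qed.

Lemma subcube_child q e : 0 < q.2 -> child (cube_of q) (cube_of (subcube q e)).
Proof. by move=> q0; exists q.1, q.2, e. Qed.

Lemma in_lattice_subcube q e : in_lattice q -> in_lattice (subcube q e).
Proof.
move=> [q0 Dq]; split; first exact: subcube_gt0.
by apply: dyadic_lattice_child Dq _ => //; exact: subcube_child.
Qed.

Lemma in_lattice_descend q s : in_lattice q -> in_lattice (descend q s).
Proof. by elim: s q => // e s IH q Dq; apply: IH; exact: in_lattice_subcube. Qed.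

Lemma descendants_descend q P : 0 < q.2 -> descendants (cube_of q) P ->
  exists s, P = cube_of (descend q s).
Proof.
move=> q0; elim=> [|P' P'' _ [s ->]]; first by exists [::].
move=> /(child_subcube (descend_gt0 s q0))[e ->].
by exists (rcons s e); rewrite descend_rcons.
Qed.

Lemma common_ancestor p q : in_lattice p -> in_lattice q ->
  exists t s1 s2, [/\ in_lattice t, p = descend t s1 & q = descend t s2].
Proof.
move=> [p0 Dp] [q0 Dq].
have [T [DT]] := dyadic_lattice_ancestor latD Dp Dq.
have [t [t0 Dt] ->] := lattice_cube_of DT.
move=> /(descendants_descend t0)[s1 pE] /(descendants_descend t0)[s2 qE].
exists t, s1, s2; split => //; apply: cube_of_inj => //; exact: descend_gt0.
Qed.

(** A cube of the lattice covering a point outside [q] has a common ancestor with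
    [q], which cannot be [q] itself. *)
Lemma parent_exists q : in_lattice q ->
  exists p, in_lattice p /\ exists e, subcube p e = q.
Proof.
move=> [q0 Dq]; pose y := q.1 + const_mx q.2 : Rn.
have [Q DQ yQ] := dyadic_lattice_compact latD (@compact_set1 _ y).
have [q' Dq' QE] := lattice_cube_of DQ.
have [t [s1 [s2 [Dt qE q'E]]]] := common_ancestor (conj q0 Dq) Dq'.
case/lastP: s1 qE => [/= qt|s e qE].
  have : cube_of q y.
    rewrite qt; apply: (@descend_sub _ _ _ s2); first by case: Dt.
    by rewrite -q'E -QE; exact: yQ.
  by move=> /cube_ofP/(_ (Ordinal n_gt0)); rewrite !mxE ltxx andbF.
exists (descend t s); split; first exact: in_lattice_descend.
by exists e; rewrite -descend_rcons.
Qed.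

Definition parent (q : cubeT) : cubeT :=
  xget q [set p | in_lattice p /\ exists e, subcube p e = q].

Lemma parent_spec q : in_lattice q ->
  in_lattice (parent q) /\ exists e, subcube (parent q) e = q.
Proof.
by move=> /parent_exists[p pq]; rewrite /parent; case: xgetP => // /(_ p).
Qed.

Lemma in_lattice_parent q : in_lattice q -> in_lattice (parent q).
Proof. by move=> /parent_spec[]. Qed.

(** Two parents of a cube have a common ancestor, below which they are
    descendants of the same generation that intersect. *)
Lemma parent_subcube q e : in_lattice q -> parent (subcube q e) = q.
Proof.
move=> Dq; have [Dp [e' pe]] := parent_spec (in_lattice_subcube e Dq).
set p := parent _ in Dp pe *.
have [t [s1 [s2 [[t0 _] pE qE]]]] := common_ancestor Dp Dq.
have x1 : cube_of (subcube q e) (subcube q e).1.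
  by apply: cube_of_corner; case: (in_lattice_subcube e Dq).
suff -> : p = descend t s2 by rewrite -qE.
rewrite pE; congr descend; apply: (descend_disjoint t0).
- have : p.2 = q.2.
    have /= := congr1 snd pe.
    by move=> /(mulIf _); apply; rewrite invr_eq0 pnatr_eq0.
  rewrite pE qE !side_descend => /(mulfI (lt0r_neq0 t0))/invr_inj.
  move=> /eqP; rewrite -!natrX eqr_nat eqn_exp2l// => /eqP //.
- by rewrite -pE; apply: (@subcube_sub _ _ _ e'); [case: Dp|rewrite pe; exact: x1].
- by rewrite -qE; apply: subcube_sub x1; case: Dq.
Qed.

Lemma iter_parent_descend q s : in_lattice q ->
  iter (size s) parent (descend q s) = q.
Proof.
elim/last_ind: s => // s e IH Dq.
rewrite size_rcons iterSr descend_rcons parent_subcube ?IH//.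
exact: in_lattice_descend.
Qed.

Lemma in_lattice_iter j q : in_lattice q -> in_lattice (iter j parent q).
Proof. by move=> Dq; elim: j => //= j; exact: in_lattice_parent. Qed.

Lemma side_parent q : in_lattice q -> (parent q).2 = 2 * q.2.
Proof.
move=> /parent_spec[_ [e /(congr1 snd)/= <-]].
by rewrite mulrCA divff ?mulr1.
Qed.

Lemma volume_parent q : in_lattice q -> volume (parent q) = 2 ^+ n * volume q.
Proof. by move=> Dq; rewrite /volume side_parent// exprMn. Qed.

Lemma parent_sub q : in_lattice q -> cube_of q `<=` cube_of (parent q).
Proof. by move=> /parent_spec[[p0 _] [e {1}<-]]; exact: subcube_sub. Qed.

Lemma iter_parent_sub j q : in_lattice q ->
  cube_of q `<=` cube_of (iter j parent q).
Proof.
move=> Dq; elim: j => //= j IH.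
by apply: subset_trans IH (parent_sub _); exact: in_lattice_iter.
Qed.

Lemma side_iter_parent j q : in_lattice q -> (iter j parent q).2 = 2 ^+ j * q.2.
Proof.
move=> Dq; elim: j => [|j IH] /=; first by rewrite mul1r.
by rewrite side_parent ?IH ?exprS ?mulrA//; exact: in_lattice_iter.
Qed.

Lemma lattice_sub_descend p q : in_lattice p -> in_lattice q ->
  cube_of p `<=` cube_of q -> exists s, p = descend q s.
Proof.
move=> Dp Dq pq.
have [t [s1 [s2 [[t0 Dt] pE qE]]]] := common_ancestor Dp Dq.
have s21 : (size s2 <= size s1)%N.
  have : p.2 <= q.2 by apply: side_le_sub pq; [case: Dp|case: Dq].
  rewrite pE qE !side_descend ler_pM2l// lef_pV2 ?posrE ?exprn_gt0//.
  by rewrite -!natrX ler_nat leq_exp2l.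
exists (drop (size s2) s1).
rewrite qE -descend_cat pE -[in LHS](cat_take_drop (size s2) s1).
congr (descend t (_ ++ _)).
have x1 : cube_of p p.1 by apply: cube_of_corner; case: Dp.
apply: (descend_disjoint t0 (x := p.1)).
- by rewrite size_takel.
- apply: (@descend_sub _ _ _ (drop (size s2) s1)); first exact: descend_gt0.
  by rewrite -descend_cat cat_take_drop -pE.
- by rewrite -qE; exact: pq.
Qed.

Variable q0 : cubeT.
Hypothesis Dq0 : in_lattice q0.

Definition chain k := iter k parent q0.

Definition in_chain q := exists k, q = chain k.

Lemma in_lattice_chain k : in_lattice (chain k).
Proof. exact: in_lattice_iter. Qed.

Lemma reach_chain q : in_lattice q -> exists j, in_chain (iter j parent q).
Proof.
move=> Dq; have [t [s1 [s2 [Dt qE q0E]]]] := common_ancestor Dq Dq0.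
exists (size s1), (size s2).
by rewrite /chain {1}qE q0E !iter_parent_descend.
Qed.

Lemma in_chain_parent q : in_chain q -> in_chain (parent q).
Proof. by move=> [k ->]; exists k.+1. Qed.

Lemma in_chain_side_inj p q : in_chain p -> in_chain q -> p.2 = q.2 -> p = q.
Proof.
move=> [j ->] [k ->]; rewrite /chain !side_iter_parent//.
move=> /(mulIf (lt0r_neq0 (proj1 Dq0)))/eqP.
by rewrite -!natrX eqr_nat eqn_exp2l// => /eqP ->.
Qed.

Lemma chain_cover (K : set Rn) : compact K ->
  exists k, K `<=` cube_of (chain k).
Proof.
move=> cK; have [Q DQ KQ] := dyadic_lattice_compact latD cK.
have [q Dq QE] := lattice_cube_of DQ.
have [j [k jk]] := reach_chain Dq; exists k; rewrite -jk.
by apply: subset_trans KQ _; rewrite QE; exact: iter_parent_sub.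
Qed.

(** Every cube reaches the chain after finitely many parents, which makes
    recursion from the chain downwards well founded. *)
Lemma lattice_ind (P : cubeT -> Prop) :
  (forall q, in_lattice q -> in_chain q -> P q) ->
  (forall q, in_lattice q -> ~ in_chain q -> P (parent q) -> P q) ->
  forall q, in_lattice q -> P q.
Proof.
move=> Pc Ps q Dq; have [j] := reach_chain Dq.
elim: j q Dq => [|j IH] q Dq; first exact: Pc.
rewrite iterSr => qj; have [/Pc|nq] := pselect (in_chain q); first exact.
by apply: Ps => //; apply: IH => //; exact: in_lattice_parent.
Qed.

(** * Stopping cubes *)

(** [misses B q] decides that the attachment [B] of the parent of [q] is no longer
    suitable for [q]. *)
Variable misses : cubeT -> cubeT -> bool.

(** Recursion on the number of generations that separate [q] from the chain. *)
Fixpoint stop_rec j q :=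
  if j is j'.+1 then
    let B := stop_rec j' (parent q) in if misses B q then q else B
  else q.

Definition height q : nat := xget 0%N [set j | in_chain (iter j parent q) /\
  forall i, (i < j)%N -> ~ in_chain (iter i parent q)].

Definition stop q := stop_rec (height q) q.

Lemma height_spec q : in_lattice q -> in_chain (iter (height q) parent q) /\
  forall i, (i < height q)%N -> ~ in_chain (iter i parent q).
Proof.
move=> Dq; rewrite /height; case: xgetP => // h; exfalso.
have [j jq] := reach_chain Dq.
have ex : exists j, `[< in_chain (iter j parent q) >].
  by exists j; apply/asboolP.
case: (ex_minnP ex) => m /asboolP mq mmin.
by apply: (h m); split => // i im /asboolP/mmin; rewrite leqNgt im.
Qed.

Lemma height_unique q m : in_lattice q -> in_chain (iter m parent q) ->
  (forall i, (i < m)%N -> ~ in_chain (iter i parent q)) -> height q = m.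
Proof.
move=> Dq mq hm; have [hq hh] := height_spec Dq.
by have [/hh|/hm|//] := ltngtP m (height q).
Qed.

Lemma stop_chain q : in_lattice q -> in_chain q -> stop q = q.
Proof. by move=> Dq cq; rewrite /stop (@height_unique _ 0). Qed.

Lemma stop_step q : in_lattice q -> ~ in_chain q ->
  stop q = if misses (stop (parent q)) q then q else stop (parent q).
Proof.
move=> Dq cq; have [hq hh] := height_spec (in_lattice_parent Dq).
rewrite {1}/stop (@height_unique _ (height (parent q)).+1)//.
  by rewrite iterSr.
by move=> [|i] //; rewrite ltnS iterSr => /hh.
Qed.

Lemma stop_ancestor q : in_lattice q ->
  stop (stop q) = stop q /\ exists j, stop q = iter j parent q.
Proof.
move: q; apply: lattice_ind => q Dq cq.
  by rewrite !stop_chain//; split => //; exists 0%N.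
move=> [idem [j pj]]; have sq := stop_step Dq cq; split.
  rewrite sq; case: ifPn => hq //.
  by rewrite sq hq.
rewrite sq; case: ifPn => _; first by exists 0%N.
by exists j.+1; rewrite iterSr.
Qed.

End lattice.

(** * The Carleson condition *)

Section esum_facts.
Context {R : realType}.
Local Open Scope ereal_scope.

Lemma esum_subset (T : choiceType) (A B : set T) (a : T -> \bar R) :
  A `<=` B -> \esum_(t in A) a t <= \esum_(t in B) a t.
Proof.
move=> AB; apply: ereal_sup_le => _ [F [finF FA] <-].
by exists F => //; split=> //; exact: subset_trans AB.
Qed.

Lemma esum_setU_le (T : choiceType) (A B : set T) (a : T -> \bar R) :
  (forall t, 0 <= a t) ->
  \esum_(t in A `|` B) a t <= \esum_(t in A) a t + \esum_(t in B) a t.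
Proof.
move=> a0; rewrite (esumID A)//; apply: leeD; apply: esum_subset.
  by move=> t [].
by move=> t [[]].
Qed.

Lemma esum_image_seq_le (U : eqType) (T : choiceType) (g : U -> T) (l : seq U)
    (a : T -> \bar R) : (forall t, 0 <= a t) ->
  \esum_(t in [set g u | u in [set` l]]) a t <= \sum_(u <- l) a (g u).
Proof.
move=> a0; elim: l => [|u l IH].
  by rewrite big_nil (_ : [set` [::]] = set0) ?image_set0 ?esum_set0//;
    apply/seteqP; split.
rewrite big_cons.
apply: le_trans (leeD2l _ IH).
rewrite -(esum_set1 (a0 (g u))).
apply: le_trans (esum_setU_le _ _ a0); apply: esum_subset.
move=> _ [w /= + <-]; rewrite inE => /orP[/eqP ->|wl]; first by left.
by right; exists w.
Qed.

End esum_facts.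

Section stopping_family.
Context {R : realType} {n : nat}.
Local Notation Rn := 'rV[R]_n.
Local Notation cubeT := (Rn * R)%type.
Local Notation corner := {ffun 'I_n -> bool}.
Implicit Types (p q t : cubeT) (s : seq corner) (e : corner).
Variable D : set (set Rn).
Hypotheses (n_gt0 : (0 < n)%N) (latD : dyadic_lattice D).
Variable q0 : cubeT.
Hypothesis Dq0 : in_lattice D q0.
Variables (lam : R) (E : cubeT -> set (euclid R n)).
Hypotheses (lam_le : lam <= 2 ^- (n + 2))
  (mE : forall q, in_lattice D q -> measurable (E q))
  (E_big : forall q, in_lattice D q ->
     (lebesgue (cube_of q `\` E q) <= (lam * volume q)%:E)%E).

Definition defect (B q : cubeT) : R := fine (lebesgue (cube_of q `\` E B)).

(** The threshold [2^-(n+1)] is small enough for the parent's attachment to fill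
    half of each child, and large enough for the cubes newly stopped below a
    stopping cube to fill at most half of it. *)
Definition misses (B q : cubeT) : bool := volume q < 2 ^+ n.+1 * defect B q.

Local Notation parent := (parent D).
Local Notation in_chain := (in_chain D q0).
Local Notation stop := (stop D q0 misses).

Lemma defectE B q : in_lattice D q ->
  lebesgue (cube_of q `\` E B) = (defect B q)%:E.
Proof.
move=> [q_gt0 _]; rewrite fineK// ge0_fin_numE; last exact: outer_measure_ge0.
rewrite (le_lt_trans (le_lebesgue (@subIsetl _ _ _)))// lebesgue_cube_of//.
exact: ltry.
Qed.

Lemma defect_ge0 B q : 0 <= defect B q.
Proof. by rewrite fine_ge0//; exact: outer_measure_ge0. Qed.

Lemma defect_self q : in_lattice D q -> 2 ^+ n.+2 * defect q q <= volume q.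
Proof.
move=> Dq; have := E_big Dq; rewrite defectE// lee_fin => h.
have v0 : 0 <= volume q by apply: volume_ge0; case: Dq.
rewrite -ler_pdivlMl ?exprn_gt0//; apply: le_trans h _.
by rewrite ler_wpM2r// (le_trans lam_le)// addn2.
Qed.

Lemma defect_self_quarter q : in_lattice D q -> 4 * defect q q <= volume q.
Proof.
move=> /defect_self; apply: le_trans; rewrite ler_wpM2r ?defect_ge0//.
rewrite (_ : 4 = 2 ^+ 2 :> R); last by rewrite -natrX.
by rewrite ler_eXn2l ?ltr1n.
Qed.

Lemma defect_sub B p q : in_lattice D p -> in_lattice D q ->
  cube_of p `<=` cube_of q -> defect B p <= defect B q.
Proof.
move=> Dp Dq pq; rewrite -lee_fin -!defectE//; apply: le_lebesgue.
exact: setSD.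
Qed.

Lemma sum_defect_subcube B q : in_lattice D B -> in_lattice D q ->
  \sum_e defect B (subcube q e) <= defect B q.
Proof.
move=> DB Dq; rewrite -lee_fin -sumEFin -defectE//.
rewrite (eq_bigr _ (fun e _ => esym (defectE B (in_lattice_subcube latD e Dq)))).
apply: sum_measure_disjoint_le.
- by move=> e; apply: measurableD (mE DB); exact: measurable_cube_of.
- by apply: measurableD (mE DB); exact: measurable_cube_of.
- by move=> e; apply: setSD; apply: subcube_sub; case: Dq.
- by move=> e e' x [xe _] [xe' _]; exact: subcube_disjoint xe xe'.
Qed.

Lemma stop_lattice q : in_lattice D q ->
  [/\ in_lattice D (stop q), stop (stop q) = stop q &
      cube_of q `<=` cube_of (stop q)].
Proof.
move=> Dq; have [idem [j jE]] := stop_ancestor n_gt0 latD Dq0 misses Dq.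
split => //; rewrite jE; first exact: in_lattice_iter.
exact: iter_parent_sub.
Qed.

Lemma defect_stop q : in_lattice D q ->
  2 ^+ n.+1 * defect (stop q) q <= volume q.
Proof.
have self p : in_lattice D p -> 2 ^+ n.+1 * defect p p <= volume p.
  move=> Dp; apply: le_trans (defect_self Dp).
  by rewrite ler_wpM2r ?defect_ge0// ler_eXn2l// ltr1n.
move: q; apply: (lattice_ind n_gt0 latD Dq0) => q Dq cq.
  by rewrite stop_chain//; exact: self.
move=> _; rewrite stop_step//; case: ifPn; first by move=> _; exact: self.
by rewrite -leNgt.
Qed.

Fixpoint below N q : seq cubeT :=
  if N is N'.+1 then
    flatten [seq subcube q e :: below N' (subcube q e) | e <- enum {: corner}]
  else [::].

Lemma mem_below N q s : (0 < size s <= N)%N -> descend q s \in below N q.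
Proof.
elim: N q s => [|N IH] q [|e s] //= sN.
apply/flatten_mapP; exists e; first by rewrite mem_enum.
case: s sN => [|e' s] sN; first by rewrite mem_head.
by rewrite inE IH ?orbT.
Qed.

Lemma below_descend N q p : p \in below N q -> exists s, p = descend q s.
Proof.
elim: N q => [|N IH] q //= /flatten_mapP[e _].
rewrite inE => /orP[/eqP ->|/IH[s ->]]; first by exists [:: e].
by exists (e :: s).
Qed.

Definition below_volume N q : R := \sum_(p <- below N q | stop p == p) volume p.

Lemma below_volumeS N q : below_volume N.+1 q =
  \sum_e ((if stop (subcube q e) == subcube q e then volume (subcube q e) else 0) +
    below_volume N (subcube q e)).
Proof.
rewrite /below_volume/= big_flatten big_map big_enum/=; apply: eq_bigr => e _.
by rewrite big_cons; case: ifP => // _; rewrite add0r.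
Qed.

(** The cubes of the chain are in the family regardless of [misses]; their total
    volume below a cube is controlled by the growth of their sides. *)
Let bonus (c : R) q := if `[< in_chain q >] then c * volume q else 0.

Let bonus_ge0 q : in_lattice D q -> 0 <= bonus 2 q.
Proof.
move=> [q_gt0 _]; rewrite /bonus; case: ifP => // _.
by rewrite mulr_ge0// volume_ge0.
Qed.

(** At most one child is in the chain, and its volume is at most half of that of
    its parent. *)
Lemma sum_bonus_subcube q : in_lattice D q ->
  \sum_e bonus 4 (subcube q e) <= bonus 2 q.
Proof.
move=> Dq; have [[e ce]|nc] := pselect (exists e, in_chain (subcube q e)).
  rewrite (bigD1 e)//= big1 ?addr0; last first.
    move=> e' ee'; rewrite /bonus asboolF// => ce'.
    have ee : subcube q e' = subcube q e.
      by apply: (in_chain_side_inj n_gt0 latD Dq0 ce' ce).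
    have : e' = e.
      have xe : cube_of (subcube q e) (subcube q e).1.
        by apply: cube_of_corner; case: (in_lattice_subcube latD e Dq).
      have xe' : cube_of (subcube q e') (subcube q e).1 by rewrite ee.
      exact: subcube_disjoint xe' xe.
    by move/eqP: ee'.
  rewrite /bonus !asboolT//; last first.
    by rewrite -(parent_subcube n_gt0 latD e Dq); exact: in_chain_parent.
  have v0 : 0 <= volume q by apply: volume_ge0; case: Dq.
  rewrite volume_subcube mulrCA mulrC ler_wpM2r//.
  rewrite ler_pdivrMr ?exprn_gt0//.
  rewrite -[X in X <= _](_ : 2 * 2 = _ :> R); last by rewrite -natrM.
  by rewrite ler_pM2l// -{1}(expr1 2) ler_eXn2l// ltr1n.
rewrite big1; first by rewrite bonus_ge0.
by move=> e _; rewrite /bonus asboolF// => ce; apply: nc; exists e.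
Qed.

(** Each child [c] is in one of three situations: in the chain, where
    [|c| + |c| + 2 |c|] is the bonus; newly stopped, where the volume of [c] is
    paid by the part of [c] that [E (stop q)] misses; or attached to [stop q],
    where the bound for [c] is already of the required form. *)
Lemma below_volume_le N q : in_lattice D q ->
  below_volume N q <= 2 ^+ n.+2 * defect (stop q) q + bonus 2 q.
Proof.
elim: N q => [|N IH] q Dq.
  rewrite /below_volume big_nil addr_ge0//.
    by rewrite mulr_ge0 ?defect_ge0.
  exact: bonus_ge0.
have [DB _ qB] := stop_lattice Dq.
rewrite below_volumeS.
apply: (@le_trans _ _ (\sum_e
    (2 ^+ n.+2 * defect (stop q) (subcube q e) + bonus 4 (subcube q e)))).
  apply: ler_sum => e _; set c := subcube q e.
  have Dc : in_lattice D c by exact: in_lattice_subcube.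
  have v0 : 0 <= volume c by apply: volume_ge0; case: Dc.
  have W := IH c Dc; have dc := defect_self Dc.
  have [cc|cc] := pselect (in_chain c).
    rewrite stop_chain// eqxx; rewrite stop_chain// in W.
    move: W; rewrite /bonus asboolT//.
    have : 0 <= 2 ^+ n.+2 * defect (stop q) c by rewrite mulr_ge0 ?defect_ge0.
    by lra.
  have sc := stop_step n_gt0 latD Dq0 misses Dc cc.
  rewrite parent_subcube// in sc.
  move: W; rewrite /bonus asboolF// !addr0 sc; case: ifPn => hv.
    rewrite eqxx => W; move: hv; rewrite /misses.
    rewrite exprS -!mulrA in dc *; rewrite [2 ^+ n.+2]exprS -!mulrA in W *.
    by lra.
  rewrite ifF ?add0r//; apply/negP => /eqP qc.
  have : cube_of q `<=` cube_of c by rewrite -qc.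
  move=> /(side_le_sub n_gt0 (proj1 Dq) (proj1 Dc)).
  by have : 0 < q.2 := proj1 Dq; rewrite /c /=; lra.
rewrite big_split/= -mulr_sumr lerD ?sum_bonus_subcube//.
by rewrite ler_wpM2l// sum_defect_subcube.
Qed.

Definition stop_family : set (set Rn) :=
  [set cube_of q | q in [set q | in_lattice D q /\ stop q = q]].

Lemma stop_family_lattice : stop_family `<=` D.
Proof. by move=> _ [q [[_ ?] _] <-]. Qed.

Lemma stop_family_regular : regular_family stop_family.
Proof.
move=> K /(chain_cover n_gt0 latD Dq0)[k Kk].
exists (cube_of (chain D q0 k)) => //.
exists (chain D q0 k) => //; split; first exact: in_lattice_chain.
by rewrite stop_chain//; [exact: in_lattice_chain|exists k].
Qed.

(** A finite part of the family inside [q] lies within finitely many generations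
    of [q]. The three terms of the estimate are [|q|] for [q] itself, [2 |q|] for
    the missed part of [q], and [2 |q|] for the chain. *)
Lemma stop_family_carleson : carleson 6 D stop_family.
Proof.
move=> Q /(lattice_cube_of latD)[q Dq ->{Q}].
rewrite lebesgue_cube_of; last by case: Dq.
apply: ge_ereal_sup => _ [F [finF FS] <-].
have v0 : 0 <= volume q by apply: volume_ge0; case: Dq.
have [N FN] : exists N, forall P, F P ->
    exists2 p, p \in [seq p <- q :: below N q | stop p == p] & P = cube_of p.
  pose listed N P :=
    exists2 p, p \in [seq p <- q :: below N q | stop p == p] & P = cube_of p.
  have depth P : F P -> exists k, forall N, (k <= N)%N -> listed N P.
    move=> /FS[[p [Dp sp] <-] pq].
    have [s ps] := lattice_sub_descend n_gt0 latD Dp Dq pq.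
    exists (size s) => N sN; exists p => //.
    rewrite mem_filter sp eqxx/=; case: s ps sN => [->|e s -> sN].
      by rewrite mem_head.
    by rewrite inE mem_below ?orbT.
  have /choice[k hk] P : exists k, F P -> forall N, (k <= N)%N -> listed N P.
    have [/depth[k hk]|nF] := pselect (F P); first by exists k.
    by exists 0%N.
  have /finite_seqP[l Fl] := finF.
  exists (\max_(P <- l) k P) => P FP; apply: hk => //.
  by apply: leq_bigmax_seq => //; move: FP; rewrite Fl.
rewrite -esum_fset//.
apply: (@le_trans _ _ (\esum_(P in [set cube_of p | p in
    [set` [seq p <- q :: below N q | stop p == p]]]) lebesgue P)%E).
  by apply: esum_subset => P /FN[p pl ->]; exists p.
apply: le_trans (esum_image_seq_le _ _ _) _.
  by move=> P; exact: outer_measure_ge0.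
have -> : (
    \sum_(p <- [seq p <- q :: below N q | stop p == p]) lebesgue (cube_of p) =
    (\sum_(p <- [seq p <- q :: below N q | stop p == p]) volume p)%:E)%E.
  rewrite -sumEFin; apply: eq_big_seq => p.
  rewrite mem_filter inE => /andP[_ pq]; apply: lebesgue_cube_of.
  case/orP: pq => [/eqP ->|/below_descend[s ->]]; first by case: Dq.
  by apply: descend_gt0; case: Dq.
rewrite -EFinM lee_fin big_filter big_cons.
have := below_volume_le N Dq; rewrite -/(below_volume N q).
have := defect_stop Dq; rewrite [2 ^+ n.+2]exprS -mulrA.
have : bonus 2 q <= 2 * volume q.
  by rewrite /bonus; case: ifP => // _; rewrite mulr_ge0.
by case: ifP => _; lra.
Qed.

End stopping_family.

(** * The pointwise bound *)

Section large_cubes.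
Context {R : realType} {n : nat}.
Local Notation Rn := 'rV[R]_n.
Local Notation cubeT := (Rn * R)%type.
Implicit Types (q : cubeT).

(** A cube around [x] lies in the centered cube of twice its side, as soon as its
    side exceeds the coordinates of [x]; the factor [2^n] between their volumes is
    absorbed by the little-o. *)
Lemma decay_large_cubes (f : euclid R n -> \bar R) (eps : R) (x : Rn) :
  (fun r : R => fine (lebesgue
     [set x : euclid R n | (forall i, - r <= (x : Rn) 0 i <= r) /\
                           (eps%:E < `|f x|)%E]))
    =o_ (pinfty_nbhs R) (fun r : R => r ^+ n) ->
  exists L : R, forall q, 0 < q.2 -> cube_of q x -> L <= q.2 ->
    (lebesgue (cube_of q `&` [set y | (eps%:E < `|f y|)%E]) <=
      (volume q / 4)%:E)%E.
Proof.
pose A := fun r : R => [set x : euclid R n |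
  (forall i, - r <= (x : Rn) 0 i <= r) /\ (eps%:E < `|f x|)%E].
rewrite -/A; move=> /eqoP/(_ (2 ^- n / 4)).
have c0 : 0 < 2 ^- n / 4 :> R by rewrite divr_gt0// invr_gt0 exprn_gt0.
move=> /(_ c0)[M [_ hM]].
exists (Num.max (`|M| + 1) (\sum_i `|x 0 i|)) => q q0 xq.
rewrite ge_max => /andP[Mq xsq].
have finA r : lebesgue (A r) \is a fin_num.
  rewrite ge0_fin_numE; last exact: outer_measure_ge0.
  apply: (@le_lt_trans _ _
      (lebesgue (box (const_mx (- r)) (const_mx (r + 1))))).
    apply: le_lebesgue => y [yr _] i; rewrite !mxE.
    by have := yr i; lra.
  by rewrite /lebesgue lebesgue_outer_box ltry.
apply: (@le_trans _ _ (lebesgue (A (2 * q.2)))).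
  apply: le_lebesgue => y [/cube_ofP yq fy]; split => // i.
  have := yq i; move/cube_ofP/(_ i) : xq.
  have : `|x 0 i| <= q.2.
    by apply: le_trans xsq; rewrite (bigD1 i)//= lerDl sumr_ge0.
  by rewrite ler_norml; lra.
have Mq2 : M < 2 * q.2 by have := ler_norm M; lra.
rewrite -(fineK (finA _)) lee_fin.
have := hM _ Mq2; rewrite /= ger0_norm; last first.
  by rewrite fine_ge0//; exact: outer_measure_ge0.
move=> /le_trans; apply.
rewrite ger0_norm; last by rewrite exprn_ge0// mulr_ge0// ltW.
rewrite exprMn -/(volume q) mulrA [2 ^- n / 4 * _]mulrAC mulVf ?mul1r; last first.
  by rewrite expf_neq0.
by rewrite mulrC.
Qed.

End large_cubes.

Section pointwise.
Context {R : realType} {n : nat}.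
Local Notation Rn := 'rV[R]_n.
Local Notation cubeT := (Rn * R)%type.
Local Notation corner := {ffun 'I_n -> bool}.
Implicit Types (p q t : cubeT) (s : seq corner) (e : corner).
Variable D : set (set Rn).
Hypotheses (n_gt0 : (0 < n)%N) (latD : dyadic_lattice D).
Variable q0 : cubeT.
Hypothesis Dq0 : in_lattice D q0.
Variables (lam : R) (E : cubeT -> set (euclid R n)).
Hypotheses (lam_le : lam <= 2 ^- (n + 2))
  (mE : forall q, in_lattice D q -> measurable (E q))
  (E_big : forall q, in_lattice D q ->
     (lebesgue (cube_of q `\` E q) <= (lam * volume q)%:E)%E).

Local Notation parent := (parent D).
Local Notation stop := (stop D q0 (misses E)).
Local Notation defect := (defect E).
Local Notation defect_stop := (defect_stop n_gt0 latD Dq0 lam_le E_big).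
Local Notation stop_lattice := (stop_lattice n_gt0 latD Dq0 E).

Lemma lebesgue_outer_null_ae (A : set (euclid R n)) (P : euclid R n -> Prop) :
  lebesgue_outer A = 0%E -> (forall x, ~ A x -> P x) ->
  {ae lebesgue, forall x, P x}.
Proof.
move=> A0 AP; exists A; split => //; last first.
  by move=> x /= nP; apply: contrapT => nA; apply: nP; exact: AP.
apply: (@le_caratheodory_measurable R Rn (@lebesgue_outer R n)) => X.
rewrite [X in (X + _ <= _)%E](_ : _ = 0%E) ?add0e.
  by apply: le_outer_measure; exact: subIsetl.
apply/eqP; rewrite eq_le outer_measure_ge0 andbT -A0.
by apply: le_outer_measure; exact: subIsetr.
Qed.

(** Inside each cube of the chain, the exceptional points of a descendant [q] lie
    in [q] minus [E (stop q)], hence fill at most a quarter of [q]. *)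
Lemma ae_covered : {ae lebesgue, forall x : euclid R n,
  exists2 q, in_lattice D q /\ cube_of q x & E (stop q) x}.
Proof.
pose B k : set Rn := [set x | cube_of (chain D q0 k) x /\
  forall s, cube_of (descend (chain D q0 k) s) x ->
    ~ E (stop (descend (chain D q0 k) s)) x].
have Dc k : in_lattice D (chain D q0 k) by exact: in_lattice_chain.
apply: (@lebesgue_outer_null_ae (\bigcup_k B k)).
  apply/eqP; rewrite eq_le outer_measure_ge0 andbT.
  apply: le_trans (outer_measure_sigma_subadditive (@lebesgue_outer R n) B) _.
  rewrite eseries0// => k _ _.
  apply: (@dyadic_density_null _ _ (chain D q0 k)).
  - by case: (Dc k).
  - by move=> x [].
  - move=> s; set q := descend _ s.
    have Dq : in_lattice D q by exact: in_lattice_descend.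
    apply: (@le_trans _ _ (defect (stop q) q)%:E).
      rewrite -(@defectE _ _ D)//; apply: le_outer_measure => x [[_ Bx] qx].
      by split => //; exact: Bx.
    rewrite lee_fin ler_pdivlMr//; apply: le_trans (defect_stop Dq).
    rewrite mulrC ler_wpM2r ?defect_ge0//.
    rewrite (_ : 4 = 2 ^+ 2 :> R); last by rewrite -natrX.
    by rewrite ler_eXn2l ?ltr1n// ltnS.
move=> x nB.
have [k /(_ x erefl) xk] :=
  chain_cover n_gt0 latD Dq0 (@compact_set1 _ (x : Rn)).
have [s [xs Es]] : exists s, cube_of (descend (chain D q0 k) s) x /\
    E (stop (descend (chain D q0 k) s)) x.
  apply: contrapT => h; apply: nB; exists k => //; split => // s xs Es.
  by apply: h; exists s.
exists (descend (chain D q0 k) s) => //; split => //.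
exact: in_lattice_descend.
Qed.

(** [E q] misses at most a quarter of [q]. The set [E (stop (parent q))] misses at
    most [2^-(n+1)] of the parent, that is half of [q] at most. *)
Lemma stop_parent_meets q : in_lattice D q ->
  exists x, E q x /\ E (stop (parent q)) x.
Proof.
move=> Dq; have [q_gt0 _] := Dq.
have Dp := in_lattice_parent n_gt0 latD Dq.
have [|x []] := @subset_overlap _ _ (cube_of q) (E q) (E (stop (parent q)));
  last by exists x.
rewrite !(@defectE _ _ D)// lebesgue_cube_of// -EFinD lte_fin.
have v0 := volume_gt0 q_gt0.
have := defect_self_quarter lam_le E_big Dq.
have := defect_sub E (stop (parent q)) Dq Dp (parent_sub n_gt0 latD Dq).
have := defect_stop Dp.
rewrite volume_parent// exprSr -mulrA ler_pM2l ?exprn_gt0//; lra.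
Qed.

Variable f : euclid R n -> \bar R.
Hypothesis E_fin : forall q x, in_lattice D q -> E q x ->
  cube_of q x /\ f x \is a fin_num.
Hypothesis E_osc : forall q x y, in_lattice D q -> E q x -> E q y ->
  (`|f x - f y| <= lambda_osc lam f (cube_of q))%E.
Hypothesis osc_ge0 : forall q, in_lattice D q ->
  (0 <= lambda_osc lam f (cube_of q))%E.

(** The chain [A] climbs from [stop q] to infinity through the family; telescoping
    [f] along points of consecutive intersections gives [chain_bound]. *)
Lemma pointwise_bound x q :
  (forall eps : R, 0 < eps -> exists L : R, forall q, 0 < q.2 -> cube_of q x ->
    L <= q.2 ->
    (lebesgue (cube_of q `&` [set y | (eps%:E < `|f y|)%E]) <=
      (volume q / 4)%:E)%E) ->
  in_lattice D q -> cube_of q x -> E (stop q) x ->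
  (`|f x| <= \esum_(Q in stop_family D q0 E)
    (lambda_osc lam f Q * (\1_Q x)%:E))%E.
Proof.
move=> decay Dq qx Ex.
pose A i := iter i (fun q => stop (parent q)) (stop q).
have [DA0 _ _] := stop_lattice Dq.
have DA i : in_lattice D (A i).
  elim: i => //= i /(in_lattice_parent n_gt0 latD) DpA.
  by have [] := stop_lattice DpA.
have SA i : stop (A i) = A i.
  case: i => [|i] /=; first by have [] := stop_lattice Dq.
  by have [] := stop_lattice (in_lattice_parent n_gt0 latD (DA i)).
have subA i : cube_of (parent (A i)) `<=` cube_of (A i.+1).
  by have [_ _] := stop_lattice (in_lattice_parent n_gt0 latD (DA i)).
have sideA i : 2 * (A i).2 <= (A i.+1).2.
  rewrite -(side_parent n_gt0 latD (DA i)); apply: side_le_sub (subA i) => //.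
    by case: (in_lattice_parent n_gt0 latD (DA i)).
  by case: (DA i.+1).
have A0 i : 0 < (A i).2 by case: (DA i).
have sideA2 i : 2 ^+ i * (A 0).2 <= (A i).2.
  elim: i => [|i IH]; first by rewrite mul1r.
  by apply: le_trans (sideA i); rewrite exprS -mulrA ler_pM2l.
have incA : {homo (fun i => (A i).2) : i j / (i < j)%N >-> i < j}.
  apply: homo_ltn; first by move=> ? ? ?; exact: lt_trans.
  by move=> i; have := sideA i; have := A0 i; lra.
have xA i : cube_of (A i) x.
  elim: i => [|i IH]; first by have [_ _] := stop_lattice Dq; apply.
  by apply: subA; apply: (parent_sub n_gt0 latD (DA i)).
pose w i := lambda_osc lam f (cube_of (A i)).
have w0 i : (0 <= w i)%E by exact: osc_ge0.
have chain_bound i y : E (A i) y ->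
    (`|f x - f y| <= \sum_(0 <= j < i.+1) w j)%E.
  elim: i y => [|i IH] y Ey; first by rewrite big_nat1; exact: E_osc.
  have [z [z1 z2]] := stop_parent_meets (DA i).
  rewrite big_nat_recr//=.
  apply: le_trans (leeD (IH z z1) (E_osc (DA i.+1) z2 Ey)).
  have [_ fx] := E_fin DA0 Ex.
  have [_ fz] := E_fin (DA i) z1; have [_ fy] := E_fin (DA i.+1) Ey.
  rewrite -(fineK fx) -(fineK fy) -(fineK fz) lee_fin.
  by rewrite -[X in `|X|](subrKA (fine (f z))) ler_normD.
apply/lee_addgt0Pr => eps eps0.
have [L hL] := decay eps eps0.
have [i Li] : exists i, L <= (A i).2.
  have Lp : 0 < `|L| + 1 by apply: ltr_wpDl.
  have [i hi] := pow2_small Lp (A0 0).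
  exists i; apply: le_trans (sideA2 i).
  move: hi; rewrite ltr_pdivrMr ?exprn_gt0// mulrC.
  by have := ler_norm L; lra.
have [|y [_ Ey fy]] :=
    @subset_overlap _ _ (cube_of (A i)) (E (A i))
      [set y | (`|f y| <= eps%:E)%E].
  apply: (@le_lt_trans _ _ ((volume (A i) / 4)%:E + (volume (A i) / 4)%:E)%E).
    apply: leeD.
      rewrite (@defectE _ _ D)// lee_fin.
      by have := defect_self_quarter lam_le E_big (DA i); lra.
    apply: le_trans (hL _ (A0 i) (xA i) Li); apply: le_lebesgue => y [Ay ny].
    by split => //=; rewrite ltNge; exact/negP.
  rewrite lebesgue_cube_of// -EFinD lte_fin.
  by have := volume_gt0 (A0 i); lra.
apply: (@le_trans _ _ (\sum_(0 <= j < i.+1) w j + eps%:E)%E).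
  apply: le_trans (leeD (chain_bound i y Ey) fy).
  have [_ fx] := E_fin DA0 Ex; have [_ fyf] := E_fin (DA i) Ey.
  rewrite -(fineK fx) -(fineK fyf) lee_fin.
  by rewrite -[X in `|X| <= _](subrK (fine (f y))) ler_normD.
rewrite leeD2r//.
apply: (@le_trans _ _ (\sum_(0 <= j <oo) w j)%E); first exact: nneseries_lim_ge.
rewrite nneseries_esumT//.
rewrite (eq_esum (b := fun j =>
    (lambda_osc lam f (cube_of (A j)) * (\1_(cube_of (A j)) x)%:E)%E)); last first.
  by move=> j _; rewrite indicE mem_set ?mule1//; exact: xA.
rewrite -(@esum_image _ _ _ setT (fun j => cube_of (A j))
  (fun Q => lambda_osc lam f Q * (\1_Q x)%:E)%E); last first.
  move=> i1 i2 _ _ /(cube_of_inj n_gt0 (A0 i1) (A0 i2)) Aij.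
  by have [/incA|/incA|//] := ltngtP i1 i2; rewrite Aij ltxx.
apply: esum_subset => _ [j _ <-].
by exists (A j).
Qed.

End pointwise.

Theorem theorem10p2 (R : realType) (n : nat) (n_gt0 : (0 < n)%N)
    (f : euclid R n -> \bar R)
    (f_measurable : measurable_fun [set: euclid R n] f)
    (f_ae_finite : {ae lebesgue, forall x, f x \is a fin_num})
    (f_decay : forall eps : R, 0 < eps ->
      (fun r : R => fine (lebesgue
         [set x : euclid R n | (forall i, - r <= (x : 'rV[R]_n) 0 i <= r) /\
                               (eps%:E < `|f x|)%E]))
        =o_ (pinfty_nbhs R) (fun r : R => r ^+ n)) :
  forall D : set (set 'rV[R]_n), dyadic_lattice D ->
  forall lam : R, 0 < lam -> lam <= 2 ^- (n + 2) ->
  exists S : set (set 'rV[R]_n),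
    [/\ S `<=` D, regular_family S, carleson 6 D S &
        {ae lebesgue, forall x : euclid R n,
          (`|f x| <= \esum_(Q in S) (lambda_osc lam f Q * (\1_Q x)%:E))%E}].
Proof.
move=> D latD lam lam0 lam_le.
have [Q DQ _] := dyadic_lattice_compact latD (@compact0 _).
have [q0 Dq0 _] := lattice_cube_of latD DQ.
have lam2 : lam < 2^-1.
  apply: le_lt_trans lam_le _; rewrite ltf_pV2 ?posrE ?exprn_gt0//.
  by rewrite -{1}(expr1 2) ltr_eXn2l ?ltr1n// addn2.
have attained (q : 'rV[R]_n * R) : exists E : set (euclid R n),
    in_lattice D q ->
    [/\ measurable E, (lebesgue (cube_of q `\` E) <= (lam * volume q)%:E)%E,
      (forall x, E x -> cube_of q x /\ f x \is a fin_num) &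
      forall x y, E x -> E y ->
        (`|f x - f y| <= lambda_osc lam f (cube_of q))%E].
  have [[q_gt0 _]|nD] := pselect (in_lattice D q); last by exists set0.
  have [E hE] := lambda_osc_attained f_measurable f_ae_finite
    (measurable_cube_of q) (volume_gt0 q_gt0) (lebesgue_cube_of q_gt0) lam0 lam2.
  by exists E.
have [E hE] := choice attained.
have mE q : in_lattice D q -> measurable (E q) by move=> /hE[].
have E_big q : in_lattice D q ->
    (lebesgue (cube_of q `\` E q) <= (lam * volume q)%:E)%E by move=> /hE[].
exists (stop_family D q0 E); split.
- exact: stop_family_lattice.
- exact: stop_family_regular.
- exact: (stop_family_carleson n_gt0 latD Dq0 lam_le mE E_big).
have := ae_covered n_gt0 latD Dq0 lam_le E_big.
apply: filterS => x [q [Dq qx] Ex].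
apply: (pointwise_bound n_gt0 latD Dq0 lam_le E_big) Dq qx Ex.
- by move=> p y /hE[_ _ + _]; exact.
- by move=> p y z /hE[_ _ _]; exact.
- move=> p [p_gt0 _].
  apply: (lambda_osc_ge0 f_ae_finite (volume_gt0 p_gt0)) => //.
  exact: lebesgue_cube_of.
- by move=> eps eps0; apply: decay_large_cubes; exact: f_decay.
Qed.
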